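(* Let $M$ be a connected compact topological manifold, possibly with boundary, let $\varphi$ be a continuous flow on $M$, and let $\alpha\in H^1(M,\mathbb Z)$ be non-zero. Then there exists a $\mathbb Z$-equivariant Lyapunov map $h\colon\widehat M_\alpha\to\mathbb R$ if and only if $\alpha$ is quasi-Lyapunov.
   Context: Flows are defined for all times; $M$ carries a metric compatible with its topology. Coverings. $\widehat M\to M$ is the universal Abelian covering of $M$; its deck group is $H_1(M,\mathbb Z)$, and the action is written $\delta\cdot x$. A class $\alpha\in H^1(M,\mathbb R)$ is viewed as a homomorphism $H_1(M,\mathbb Z)\to\mathbb R$, with kernel $\ker_{\mathbb Z}(\alpha)$. Set $\widehat M_\alpha=\widehat M/\ker_{\mathbb Z}(\alpha)$, a covering $\pi_\alpha\colon\widehat M_\alpha\to M$ with deck group $H_1(M,\mathbb Z)/\ker_{\mathbb Z}(\alpha)$. The flow $\varphi$ lifts to flows on $\widehat M$ and $\widehat M_\alpha$, still denoted $\varphi$. Covering spaces of $M$ carry a metric invariant under deck transformations for which the projection to $M$ restricted to every ball of sufficiently small radius is an isometry onto its image. When $\alpha\in H^1(M,\mathbb Z)\setminus\{0\}$, write $\alpha=n\beta$ with $n\ge1$ and $\beta$ primitive (i.e. $\beta(H_1(M,\mathbb Z))=\mathbb Z$); the deck group is identified with $\mathbb Z$ via $\beta$. A map $h\colon\widehat M_\alpha\to\mathbb R$ is $\mathbb Z$-equivariant if $h(k\cdot x)=h(x)+k$ for all $k\in\mathbb Z$ and all $x$. A function $f$ on $\widehat M$ or $\widehat M_\alpha$ is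 $\alpha$-equivariant if $f(\delta\cdot x)=f(x)+\alpha(\delta)$ for all $\delta\in H_1(M,\mathbb Z)$ and all $x$. Pseudo-orbits. Let $N$ be $M$ or one of these coverings, with its flow $\psi$ and metric $d$, and fix $T>0$. For $\epsilon>0$, an $\epsilon$-pseudo-orbit is a right-continuous map $\gamma\colon[0,l)\to N$, $l>0$ (the length $\mathrm{len}(\gamma)$), continuous outside a finite set $\Delta\subset[T,l)$ whose distinct points are at distance at least $T$ from each other, such that $\gamma(s)=\psi_{s-t}(\gamma(t))$ whenever $\gamma$ is continuous on $[t,s]$, and $d(\gamma(u),\gamma(u^-))<\epsilon$ for $u\in\Delta$, where $\gamma(u^-)=\lim_{t\to u^-}\gamma(t)$. It goes from $\gamma(0)$ to $\gamma(l^-)$. Write $x\rightsquigarrow y$ if for every $\epsilon>0$ there is an $\epsilon$-pseudo-orbit from $x$ to $y$ (this does not depend on $T$). A point $x$ is recurrent if $x\rightsquigarrow x$; recurrence chains are the classes of the equivalence relation ($x\rightsquigarrow y$ and $y\rightsquigarrow x$) on the set of recurrent points (the recurrent set). A continuous map $f\colon N\to\mathbb R$ is Lyapunov if it is constant on every recurrence chain, takes distinct values on distinct recurrence chains, and is (strictly) decreasing along the flow outside the recurrent set. A continuous $\alpha$-equivariant map $f\colon\widehat M\to\mathbb R$ is quasi-Lyapunov if there are $C\ge0$ and $\epsilon>0$ such that $f(\gamma(0))\ge f(\gamma(t))-C$ for every $\epsilon$-pseudo-orbit $\gamma$ in $\widehat M$ and every $t\in[0,\mathrm{len}(\gamma))$.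 The class $\alpha$ is quasi-Lyapunov if every continuous $\alpha$-equivariant map $\widehat M\to\mathbb R$ is quasi-Lyapunov (equivalently, some such map is). *)

(* Defs.v *)
From HB Require Import structures.
From mathcomp Require Import all_boot all_order all_algebra.
From mathcomp Require Import all_classical all_reals.
From mathcomp Require Import topology normedtype.
From mathcomp Require Import freeg.

Set Implicit Arguments.
Unset Strict Implicit.
Unset Printing Implicit Defensive.

Import Order.TTheory GRing.Theory Num.Theory.
Import numFieldNormedType.Exports.

Local Open Scope classical_set_scope.
Local Open Scope ring_scope.

Definition std_simplex (R : realType) (n : nat) : set 'rV[R]_n.+1 :=
  [set t | (forall i, 0 <= t ord0 i) /\ \sum_i t ord0 i = 1].

Lemma vertex_subproof (R : realType) (n : nat) (i : 'I_n.+1) :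
  @delta_mx R 1 n.+1 ord0 i \in @std_simplex R n.
Proof.
rewrite inE; split=> [j|]; first by rewrite mxE /= ler0n.
rewrite (bigD1 i) //= mxE !eqxx big1 ?addr0 // => j ji.
by rewrite mxE (negbTE ji) andbF.
Qed.

Definition vertex (R : realType) (n : nat) (i : 'I_n.+1) :
    set_type (@std_simplex R n) :=
  exist _ (delta_mx ord0 i) (vertex_subproof R i).

Definition face_row (R : realType) (n : nat) (i : 'I_n.+2)
    (t : 'rV[R]_n.+1) : 'rV[R]_n.+2 :=
  \row_j (if unlift i j is Some k then t ord0 k else 0).

Lemma face_subproof (R : realType) (n : nat) (i : 'I_n.+2)
    (t : set_type (@std_simplex R n)) :
  face_row i (val t) \in @std_simplex R n.+1.
Proof.
have := set_mem (valP t); case=> t0 t1; rewrite inE; split=> [j|].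
  by rewrite mxE; case: unliftP.
rewrite (bigD1_ord i) //= mxE unlift_none add0r -[RHS]t1.
by apply: eq_bigr => j _; rewrite mxE liftK.
Qed.

Definition face (R : realType) (n : nat) (i : 'I_n.+2)
    (t : set_type (@std_simplex R n)) : set_type (@std_simplex R n.+1) :=
  exist _ (face_row i (val t)) (face_subproof i t).

Lemma face_continuous (R : realType) (n : nat) (i : 'I_n.+2) :
  continuous (@face R n i).
Proof.
apply: continuous_comp_initial => t.
apply: (@continuous_comp _ _ _ set_val (face_row i)).
  exact: initial_continuous.
move=> A [P tP PA].
exists (fun _ k => P ord0 (fintype.lift i k)) => [j k|s sP].
  by have := tP ord0 (fintype.lift i k); rewrite mxE liftK (ord1 j).
apply: PA => j k; rewrite mxE (ord1 j); case: unliftP => [l ->|ki].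
  exact: sP.
by have := nbhs_singleton (tP ord0 k); rewrite mxE ki unlift_none.
Qed.

HB.instance Definition _ (R : realType) (n : nat) (i : 'I_n.+2) :=
  isContinuous.Build _ _ (@face R n i) (@face_continuous R n i).

Definition singular (R : realType) (X : topologicalType) (n : nat) : Type :=
  continuousType (set_type (@std_simplex R n)) X.

HB.instance Definition _ (R : realType) (X : topologicalType) (n : nat) :=
  Choice.on (singular R X n).

Notation chain R X n := {freeg (singular R X n) / int}.

Definition boundary (R : realType) (X : topologicalType) (n : nat) :
    chain R X n.+1 -> chain R X n :=
  fglift (fun s : singular R X n.+1 =>
    \sum_(i < n.+2) (-1 : int) ^+ i *: << (s \o face i : singular R X n) >>).

Definition is_cycle1 (R : realType) (X : topologicalType) : pred (chain R X 1) :=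
  fun c => boundary c == 0.

Lemma boundary_is_additive (R : realType) (X : topologicalType) (n : nat) :
  {morph @boundary R X n : x y / x - y}.
Proof. exact: lift_is_additive. Qed.

HB.instance Definition _ (R : realType) (X : topologicalType) (n : nat) :=
  GRing.isZmodMorphism.Build _ _ (@boundary R X n)
    (@boundary_is_additive R X n).

Lemma is_cycle1_zmod_closed (R : realType) (X : topologicalType) :
  zmod_closed (@is_cycle1 R X).
Proof.
split=> [|x y]; rewrite !unfold_in; first by rewrite raddf0.
by move=> /eqP x0 /eqP y0; rewrite raddfB /= x0 y0 subrr.
Qed.

HB.instance Definition _ (R : realType) (X : topologicalType) :=
  GRing.isZmodClosed.Build (chain R X 1) (@is_cycle1 R X)
    (@is_cycle1_zmod_closed R X).

Record cycle1 (R : realType) (X : topologicalType) := Cycle1 {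
  cycle1_chain :> chain R X 1;
  _ : is_cycle1 cycle1_chain
}.

HB.instance Definition _ (R : realType) (X : topologicalType) :=
  [isSub for @cycle1_chain R X].
HB.instance Definition _ (R : realType) (X : topologicalType) :=
  [Choice of cycle1 R X by <:].
HB.instance Definition _ (R : realType) (X : topologicalType) :=
  [SubChoice_isSubZmodule of cycle1 R X by <:].

Definition is_boundary1 (R : realType) (X : topologicalType) :
    pred (cycle1 R X) :=
  fun z => `[< exists c : chain R X 2, boundary c = cycle1_chain z >].

Lemma is_boundary1_zmod_closed (R : realType) (X : topologicalType) :
  zmod_closed (@is_boundary1 R X).
Proof.
split=> [|x y]; rewrite !unfold_in.
  by apply/asboolP; exists 0; rewrite raddf0.
move=> /asboolP[c cx] /asboolP[d dy]; apply/asboolP; exists (c - d).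
by rewrite raddfB /= cx dy.
Qed.

HB.instance Definition _ (R : realType) (X : topologicalType) :=
  GRing.isZmodClosed.Build (cycle1 R X) (@is_boundary1 R X)
    (@is_boundary1_zmod_closed R X).

Definition H1 (R : realType) (X : topologicalType) : zmodType :=
  Quotient.quot (GRing.ZmodClosed.clone _ (@is_boundary1 R X) _).

Definition homology_class (R : realType) (X : topologicalType)
    (z : cycle1 R X) : H1 R X :=
  (\pi_(Quotient.quot (GRing.ZmodClosed.clone _ (@is_boundary1 R X) _)) z)%qT.

(* A degree-1 integral cohomology class is a morphism H_1(X, Z) -> Z; this is
   its image in real cohomology. *)
Definition real_class (R : realType) (X : topologicalType)
    (alpha : {additive H1 R X -> int}) : {additive H1 R X -> R} :=
  (intmul 1 : {additive int -> R}) \o alpha.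

Definition half_space (R : realType) (n : nat) : set 'rV[R]_n :=
  [set v | forall i : 'I_n, val i = 0%N -> 0 <= v ord0 i].

Definition homeomorphism_between (X Y : topologicalType) (A : set X)
    (B : set Y) (f : X -> Y) : Prop :=
  {within A, continuous f} /\
  exists g : Y -> X,
    [/\ {within B, continuous g}, set_fun A B f, set_fun B A g,
        {in A, cancel f g} & {in B, cancel g f}].

(* Separation and second countability are not repeated: the spaces below are
   compact metric spaces. *)
Definition manifold_with_boundary (R : realType) (X : topologicalType) : Prop :=
  exists n : nat, forall x : X,
  exists (U : set X) (V : set 'rV[R]_n) (f : X -> 'rV[R]_n),
    [/\ open_nbhs x U, open V &
        homeomorphism_between U (V `&` @half_space R n) f].

Record is_flow (R : realType) (N : topologicalType) (psi : R -> N -> N) :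
    Prop := {
  flow_continuous : continuous (fun z : R * N => psi z.1 z.2);
  flow0 : forall x, psi 0 x = x;
  flowD : forall s t x, psi (s + t) x = psi s (psi t x)
}.

Definition flow_lift (R : realType) (E B : Type) (p : E -> B)
    (psi : R -> E -> E) (phi : R -> B -> B) : Prop :=
  forall t x, p (psi t x) = phi t (p x).

Definition covering_map (E B : topologicalType) (p : E -> B) : Prop :=
  forall b : B, exists (U : set B) (S : set (set E)),
    [/\ open_nbhs b U, p @^-1` U = \bigcup_(V in S) V,
        trivIset S id &
        forall V, S V -> open V /\ homeomorphism_between V U p].

(* The deck group of the universal Abelian covering is H_1(M, Z); cover_class
   is the usual identification: any path from x to a . x projects to a loop
   whose homology class is a. *)
Record universal_abelian_cover (R : realType) (M E : topologicalType)
    (p : continuousType E M) (act : H1 R M -> E -> E) : Prop := {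
  cover_covering : covering_map p;
  cover_surjective : forall y, exists x, p x = y;
  cover_connected : connected [set: E];
  act_continuous : forall a, continuous (act a);
  act0 : forall x, act 0 x = x;
  actD : forall a b x, act (a + b) x = act a (act b x);
  act_free : forall a x, act a x = x -> a = 0;
  act_fibre : forall x y, p x = p y <-> exists a, y = act a x;
  cover_class : forall (c : singular R E 1) (a : H1 R M),
    c (vertex R ord_max) = act a (c (vertex R ord0)) ->
    exists2 z : cycle1 R M,
      cycle1_chain z = << (p \o c : singular R M 1) >> &
      homology_class z = a
}.

(* q : E -> Ea is the quotient of E by the kernel of alpha, pa : Ea -> M the
   induced projection, and deck the action on Ea of
   H_1(M, Z) / ker(alpha), identified with Z through the primitive class beta
   (which has the same kernel as alpha). *)
Record kernel_quotient_cover (R : realType) (M E Ea : topologicalType)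
    (p : E -> M) (act : H1 R M -> E -> E) (alpha beta : H1 R M -> int)
    (q : E -> Ea) (pa : Ea -> M) (deck : int -> Ea -> Ea) : Prop := {
  quot_surjective : forall y, exists x, q x = y;
  quot_open : forall U : set Ea, open U <-> open (q @^-1` U);
  quot_fibre : forall x y,
    q x = q y <-> exists a, alpha a = 0 /\ y = act a x;
  quot_proj : forall x, pa (q x) = p x;
  quot_deck : forall a x, deck (beta a) (q x) = q (act a x)
}.

Record cover_metric (R : realType) (M E : metricType R) (G : Type)
    (p : E -> M) (deck : G -> E -> E) : Prop := {
  metric_deck : forall g x y, mdist (deck g x) (deck g y) = mdist x y;
  metric_local : exists2 r : R, 0 < r & forall x y z,
    ball x r y -> ball x r z -> mdist (p y) (p z) = mdist y z
}.

Definition primitive_class (R : realType) (X : topologicalType)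
    (beta : {additive H1 R X -> int}) : Prop :=
  forall k : int, exists a, beta a = k.

Lemma primitive_factor (R : realType) (X : topologicalType)
    (alpha : {additive H1 R X -> int}) : (exists a, alpha a <> 0) ->
  exists (n : nat) (beta : {additive H1 R X -> int}),
    [/\ (1 <= n)%N, primitive_class beta & forall a, alpha a = n%:Z * beta a].
Proof.
move=> [a1 a1N0].
pose P (k : nat) : bool := (0 < k)%N && `[< exists a, alpha a = k%:Z >].
have exP : exists k, P k.
  exists `|alpha a1|%N; rewrite /P absz_gt0 (introN eqP a1N0) /=.
  apply/asboolP; case: (ger0P (alpha a1)) => a1_ge0.
    by exists a1; rewrite gez0_abs.
  by exists (- a1); rewrite raddfN ltz0_abs.
have [n /andP[n_gt0 /asboolP[a0 a0n]] n_min] := ex_minnP exP.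
have nN0 : n%:Z != 0 by rewrite -lt0n.
have dvd a : (n %| alpha a)%Z.
  apply/dvdz_mod0P/eqP; apply: contraT => modN0.
  have mod_ge0 := modz_ge0 (alpha a) nN0.
  have /n_min : P `|alpha a %% n|%Z%N.
    rewrite /P absz_gt0 modN0 /=; apply/asboolP.
    exists (a - a0 *~ (alpha a %/ n)%Z).
    by rewrite gez0_abs // raddfB raddfMz /= a0n /modz mulrzz mulrC.
  by rewrite -lez_nat gez0_abs // leNgt ltz_pmod.
pose b a := (alpha a %/ n)%Z.
have bE a : alpha a = n%:Z * b a by rewrite mulrC divzK.
have bB : {morph b : x y / x - y}.
  by move=> x y; apply: (mulfI nN0); rewrite mulrBr -!bE raddfB.
pose bA := GRing.isZmodMorphism.Build _ _ b bB.
pose beta : {additive H1 R X -> int} := HB.pack b bA.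
exists n, beta; split=> // k; exists (a0 *~ k).
by apply: (mulfI nN0); rewrite -bE raddfMz /= a0n mulrzz.
Qed.

Definition Z_equivariant (R : realType) (N : Type) (deck : int -> N -> N)
    (h : N -> R) : Prop :=
  forall k x, h (deck k x) = h x + k%:~R.

Definition class_equivariant (R : realType) (M : topologicalType) (E : Type)
    (act : H1 R M -> E -> E) (alpha : {additive H1 R M -> R}) (f : E -> R) :
    Prop :=
  forall a x, f (act a x) = f x + alpha a.

(* The pseudo-orbit is the restriction of gamma to [0, l); the values of gamma
   elsewhere are irrelevant. *)
Record pseudo_orbit (R : realType) (N : metricType R) (psi : R -> N -> N)
    (T eps l : R) (gamma : R -> N) : Prop := {
  po_length : 0 < l;
  po_right_continuous : forall t : R, 0 <= t < l -> gamma @ t^'+ --> gamma t;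
  po_jumps : exists Delta : set R,
    [/\ finite_set Delta,
        Delta `<=` [set u : R | T <= u < l],
        forall u v, Delta u -> Delta v -> u != v -> T <= `|u - v|,
        forall t : R, 0 <= t < l -> ~ Delta t ->
          gamma @ within [set s : R | 0 <= s < l] (nbhs t) --> gamma t &
        forall u, Delta u ->
          exists2 z, gamma @ u^'- --> z & mdist (gamma u) z < eps];
  po_flow : forall t s : R, 0 <= t -> t <= s -> s < l ->
    {within [set u : R | t <= u <= s], continuous gamma} ->
    gamma s = psi (s - t) (gamma t)
}.

Definition leads_to (R : realType) (N : metricType R) (psi : R -> N -> N)
    (T : R) (x y : N) : Prop :=
  forall eps : R, 0 < eps -> exists (l : R) (gamma : R -> N),
    [/\ pseudo_orbit psi T eps l gamma, gamma 0 = x & gamma @ l^'- --> y].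

Definition recurrent (R : realType) (N : metricType R) (psi : R -> N -> N)
    (T : R) : set N := [set x | leads_to psi T x x].

Definition recurrence_chain (R : realType) (N : metricType R)
    (psi : R -> N -> N) (T : R) (K : set N) : Prop :=
  exists2 x, recurrent psi T x &
    K = [set y | recurrent psi T y /\
                 leads_to psi T x y /\ leads_to psi T y x].

Record lyapunov (R : realType) (N : metricType R) (psi : R -> N -> N)
    (T : R) (f : N -> R) : Prop := {
  lyapunov_continuous : continuous f;
  lyapunov_constant : forall K, recurrence_chain psi T K ->
    forall x y, K x -> K y -> f x = f y;
  lyapunov_distinct : forall K L,
    recurrence_chain psi T K -> recurrence_chain psi T L -> K <> L ->
    forall x y, K x -> L y -> f x <> f y;
  lyapunov_decreasing : forall (x : N) (t : R),
    ~ recurrent psi T x -> 0 < t -> f (psi t x) < f x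
}.

Definition quasi_lyapunov (R : realType) (N : metricType R)
    (psi : R -> N -> N) (T : R) (f : N -> R) : Prop :=
  exists C eps : R, [/\ 0 <= C, 0 < eps &
    forall l gamma, pseudo_orbit psi T eps l gamma ->
    forall t : R, 0 <= t < l -> f (gamma 0) >= f (gamma t) - C].

Definition quasi_lyapunov_class (R : realType) (M : topologicalType)
    (E : metricType R) (act : H1 R M -> E -> E) (psi : R -> E -> E) (T : R)
    (alpha : {additive H1 R M -> R}) : Prop :=
  forall f : E -> R, continuous f -> class_equivariant act alpha f ->
    quasi_lyapunov psi T f.

(* Main.v *)
(* Replace pseudo-orbits by chains of jumps: flow for a time in [T, 2T], then move by
   less than eps. Every invariant local estimate is uniform on the coverings, because M is
   compact and the deck groups act by isometries.

   If h is Lyapunov, some c is not a value of h on the recurrent set: otherwise, for every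
   eps, the recurrent points of levels c and c' are eps-linked both ways when c' is close to
   c, hence for all c and c' as R is connected, and all levels would lie in one recurrence
   chain. At the levels c + k the flow then decreases h by a uniform amount, so chains with
   small jumps never climb through them and h increases by at most 1 along such a chain. By
   compactness any alpha-equivariant function is within a bounded distance of n h.

   Conversely, let F be continuous and Z-equivariant; being quasi-Lyapunov bounds F(y) - F(x)
   by C when y is reached from x by small jumps. Given a point a and a small eps, let
   g(y) = floor (F y), raised by a constant D > 2 C + 6 when y lies on the orbit of a, and let
   L(x) be the maximum of g over the points reached from x. It is integer-valued, equivariant,
   non-increasing under jumps. The supremum of L(y) - N d(psi_s x, y) over 0 <= s <= T and
   d(psi_s x, y) < eps is continuous, non-increasing along the flow, and equals L on the
   recurrent set. For a ranging over a countable dense set and eps over a sequence going to 0,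
   these functions separate the recurrence chains. The sum of these functions and of their
   translates by times in [0, 3 T], with weights (1 - l) l^i, is Lyapunov: the values of each
   term at two recurrent points differ by an integer and all terms are within B of F, so that
   l < 1 / (4 B) makes the sum injective on recurrence chains; the translates make it strictly
   decreasing off the recurrent set. *)

Require Import Defs.
From mathcomp Require Import all_boot all_order all_algebra.
From mathcomp Require Import all_classical all_reals.
From mathcomp Require Import topology normedtype sequences.
From mathcomp Require Import ring lra zify.

Set Implicit Arguments.
Unset Strict Implicit.
Unset Printing Implicit Defensive.

Import Order.TTheory GRing.Theory Num.Theory.
Import numFieldNormedType.Exports.

Local Open Scope classical_set_scope.
Local Open Scope ring_scope.

Ltac arith := intros; lra.

(** * Limits and continuity in terms of distances *)

Section EpsilonDelta.
Variables (R : realType) (N : metricType R).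

Lemma near_mdistP (x : N) (P : N -> Prop) :
  (\forall y \near x, P y) <->
  exists2 d : R, 0 < d & forall y, mdist x y < d -> P y.
Proof. exact: metricType_numDomainType.nbhs_mdistP. Qed.

Lemma near_withinP (A : set R) (u : R) (P : R -> Prop) :
  (\forall w \near within A (nbhs u), P w) <->
  exists2 d : R, 0 < d & forall w, A w -> `|w - u| < d -> P w.
Proof.
rewrite near_withinE; split => [/nbhs_ballP[d /= d0 dP]|[d d0 dP]].
  by exists d => // w Aw wu; apply: dP Aw; rewrite /ball /= distrC.
by apply/nbhs_ballP; exists d => // w /=; rewrite /ball /= distrC => wu Aw; apply: dP.
Qed.

Lemma cvg_withinP (A : set R) (u : R) (f : R -> N) (z : N) :
  f @ within A (nbhs u) --> z <->
  forall e : R, 0 < e -> exists2 d : R, 0 < d &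
    forall w, A w -> `|w - u| < d -> mdist z (f w) < e.
Proof.
by split=> [/metricType_numDomainType.cvgrPdist_lt fz e /fz/near_withinP//|fz];
  apply/metricType_numDomainType.cvgrPdist_lt => e /fz/near_withinP.
Qed.

Lemma continuous_withinP (A : set R) (f : R -> N) :
  {within A, continuous f} <->
  forall u, A u -> f @ within A (nbhs u) --> f u.
Proof. exact: subspace_continuousP. Qed.

End EpsilonDelta.

(** * Pseudo-orbits and chains of jumps *)

Section Reach.
Variables (R : realType) (N : metricType R) (psi : R -> N -> N) (T : R).
Hypotheses (psi_flow : is_flow psi) (T_gt0 : 0 < T).

Ltac arithT := have := T_gt0; arith.

Implicit Types (eps e d t s u v l : R) (x y z : N) (gamma : R -> N).

(* Bounding [t] by [2 * T] makes uniform continuity of the flow available at every jump;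
   longer flow times are subdivided in [reach_flow]. *)
Definition jump (eps : R) (x y : N) :=
  exists2 t : R, T <= t <= 2 * T & mdist (psi t x) y < eps.

(** A chain has at least one jump, so [reach eps x x] is a genuine return. *)
Inductive reach (eps : R) : N -> N -> Prop :=
| reach_jump x y of jump eps x y : reach eps x y
| reach_cons x y z of jump eps x y & reach eps y z : reach eps x z.

Lemma reach_inv eps x y : reach eps x y ->
  jump eps x y \/ exists2 z, jump eps x z & reach eps z y.
Proof. by case=> [{}x {}y|{}x z {}y xz zy]; [left|right; exists z]. Qed.

Lemma reach_trans eps y x z : reach eps x y -> reach eps y z -> reach eps x z.
Proof.
move=> xy yz; elim: xy yz => [{}x {}y xy|{}x {}y w xy _ IH] yz.
  exact: reach_cons xy yz.
exact: reach_cons xy (IH yz).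
Qed.

Lemma jump_le eps eps' x y : eps <= eps' -> jump eps x y -> jump eps' x y.
Proof. by move=> le [t tT xy]; exists t => //; exact: lt_le_trans le. Qed.

Lemma reach_le eps eps' x y : eps <= eps' -> reach eps x y -> reach eps' x y.
Proof.
move=> le; elim=> [{}x {}y xy|{}x {}y w xy _ IH].
  by apply: reach_jump; apply: jump_le xy.
by apply: reach_cons IH; apply: jump_le xy.
Qed.

(** Exact jumps of time [T] are peeled off while [t > 2 * T]; the remaining time stays above [T]. *)
Lemma reach_flow eps t x y : 0 < eps -> T <= t ->
  mdist (psi t x) y < eps -> reach eps x y.
Proof.
move=> eps0 Tt; have [n tn] : exists n : nat, t < n%:R * T.
  have [n nt] : exists n : nat, t / T < n%:R.
    by exists (Num.truncn (t / T)).+1; rewrite truncnS_gt.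
  by exists n; rewrite -ltr_pdivrMr.
elim: n t x Tt tn => [|n IH] t x Tt tn xy; first by exfalso; move: tn; rewrite mul0r; arithT.
have [t2|t2] := leP t (2 * T).
  by apply: reach_jump; exists t => //; rewrite Tt.
apply: (@reach_cons _ _ (psi T x)); first by exists T; [arithT|rewrite mdistxx].
apply: (IH (t - T)); [arithT|move: tn; rewrite -natr1; arithT|].
by rewrite -flowD // subrK.
Qed.

Lemma orbit_continuous x : continuous (psi ^~ x).
Proof.
move=> t; have tx : (fun s : R => (s, x)) @ t --> (t, x).
  by apply: (@cvg_pair _ _ _ (nbhs t) (nbhs t) (nbhs x)); [exact: cvg_id|exact: cvg_cst].
exact: cvg_comp tx (@flow_continuous _ _ _ psi_flow (t, x)).
Qed.

Lemma orbit_near x t e : 0 < e -> exists2 d : R, 0 < d &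
  forall w, `|w - t| < d -> mdist (psi t x) (psi w x) < e.
Proof.
move=> e0; have /metricType_numDomainType.cvgrPdist_lt/(_ e e0) := @orbit_continuous x t.
move=> /nbhs_ballP[d /= d0 dP]; exists d => // w wt.
by apply: dP; rewrite /ball /= distrC.
Qed.

Lemma orbit_cvg_within x t (A : set R) : psi ^~ x @ within A (nbhs t) --> psi t x.
Proof.
apply/cvg_withinP => e /(orbit_near x t)[d d0 dP]; exists d => // w _; exact: dP.
Qed.

Lemma left_cvg_unique (f : R -> N) (u : R) (y z : N) :
  f @ u^'- --> y -> f @ u^'- --> z -> y = z.
Proof. by apply: cvg_unique; exact: metric_hausdorff. Qed.

(** * From pseudo-orbits to chains of jumps *)

Section ExtractReach.
Variables (eps l : R) (gamma : R -> N).
Hypotheses (eps_gt0 : 0 < eps) (po : pseudo_orbit psi T eps l gamma).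
Variable Delta : set R.
Hypotheses (DeltaT : Delta `<=` [set u : R | T <= u < l])
  (Delta_sep : forall u v, Delta u -> Delta v -> u != v -> T <= `|u - v|)
  (Delta_cont : forall t : R, 0 <= t < l -> ~ Delta t ->
    gamma @ within [set s : R | 0 <= s < l] (nbhs t) --> gamma t)
  (Delta_jump : forall u, Delta u ->
    exists2 z, gamma @ u^'- --> z & mdist (gamma u) z < eps).

(** The left end [u] may be a jump: on [[u, v]] only the right continuity of [gamma] matters
    there. *)
Lemma flow_off_jumps u v : 0 <= u -> u <= v -> v < l ->
  (forall w, u < w -> w <= v -> ~ Delta w) -> gamma v = psi (v - u) (gamma u).
Proof.
move=> u0 uv vl noD; apply: (po_flow po) => //.
apply/continuous_withinP => w /= /andP[uw wv]; apply/cvg_withinP => e e0.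
have [->{wv w uw}|wu] := eqVneq w u.
  have /(po_right_continuous po)/cvg_withinP/(_ e e0)[d d0 dP] : 0 <= u < l by arithT.
  exists d => // s /= /andP[us _] su; have [<-|su'] := eqVneq u s.
    by rewrite mdistxx.
  by apply: dP => //; rewrite lt_neqAle su'.
have uw' : u < w by rewrite lt_neqAle eq_sym wu.
have /Delta_cont/(_ (noD _ uw' wv))/cvg_withinP/(_ e e0)[d d0 dP] : 0 <= w < l by arithT.
by exists d => // s /= sv; apply: dP => /=; arithT.
Qed.

Lemma left_limit_off_jumps v u : 0 <= v -> v < u -> u <= l ->
  (forall w, v < w -> w < u -> ~ Delta w) ->
  gamma @ u^'- --> psi (u - v) (gamma v).
Proof.
move=> v0 vu ul noD; apply/cvg_withinP => e /(orbit_near (gamma v) (u - v))[d d0 dP].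
exists (Num.min d (u - v)) => [|w /= wu]; first by rewrite lt_min d0 subr_gt0.
rewrite lt_min => /andP[wd wv].
rewrite (@flow_off_jumps v w) //; [|by move: wv; rewrite ltr_norml; arithT|arithT|].
  apply: dP; move: wd; congr (_ < _); congr (`|_|); arithT.
by move=> s vs sw; apply: noD => //; arithT.
Qed.

(** The time [v] is the last jump before [u], or 0 if there is none. It is found by scanning a list
    of the jumps and moving [v] to each one met between [v] and [u]. *)
Lemma previous_jump u : finite_set Delta -> 0 < u ->
  exists v, [/\ 0 <= v < u, v = 0 \/ Delta v &
    forall w, v < w -> w < u -> ~ Delta w].
Proof.
move=> /finite_seqP[s sD] u0.
suff [v [vu v0 vmax]] : exists v, [/\ 0 <= v < u, v = 0 \/ Delta v &
    forall w, w \in s -> v < w -> u <= w].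
  exists v; split => // w vw wu; by rewrite sD => /= /vmax/(_ vw); rewrite leNgt wu.
have: {subset s <= Delta} by move=> w ws; rewrite inE sD.
elim: {sD} s => [_|a s IH sub]; first by exists 0; split=> //; [arithT|left].
have [|v [vu v0 vmax]] := IH; first by move=> w ws; apply: sub; rewrite inE ws orbT.
have [/andP[va au]|nvau] := boolP (v < a < u).
  exists a; split; [arithT|by right; apply/set_mem/sub; rewrite mem_head|].
  move=> w; rewrite inE => /orP[/eqP ->|/vmax vw aw]; first by rewrite ltxx.
  by apply: vw; arithT.
exists v; split => // w; rewrite inE => /orP[/eqP -> va|/vmax]; last exact.
by move: nvau; rewrite va /= -leNgt.
Qed.

(** The left limit at [u] is the end of the orbit piece starting at [gamma v], so this piece and the
    discontinuity at [u] make one jump, subdivided by [reach_flow] if it is long. *)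
Lemma jump_reach v u : 0 <= v -> v + T <= u -> Delta u ->
  (forall w, v < w -> w < u -> ~ Delta w) -> reach eps (gamma v) (gamma u).
Proof.
move=> v0 vu Du noD; have /= Tul := DeltaT Du.
have [z gz zu] := Delta_jump Du.
apply: (@reach_flow _ (u - v)) => //; first arithT.
have -> : psi (u - v) (gamma v) = z; last by rewrite metric_sym.
apply: left_cvg_unique gz; apply: left_limit_off_jumps => //; arithT.
Qed.

(** Jumps are at least [T] apart and the first one is not before [T]: each orbit piece is long
    enough, and going back one jump lowers the bound on [u / T] by 1. *)
Lemma reach_jump_point u : finite_set Delta -> Delta u -> reach eps (gamma 0) (gamma u).
Proof.
move=> finD; have [n un] : exists n : nat, u < n%:R * T.
  exists (Num.truncn (u / T)).+1; rewrite -ltr_pdivrMr //; exact: truncnS_gt.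
elim: n u un => [|n IH] u un Du; have /= Tul := DeltaT Du.
  by move: un; rewrite mul0r; arithT.
have [|v [v0u [v0|Dv] noD]] := @previous_jump u finD; first arithT.
  by rewrite -v0; apply: jump_reach => //; arithT.
have uv : v + T <= u.
  have /Delta_sep/(_ Dv) := Du; have -> : u != v by rewrite gt_eqF; arithT.
  by move=> /(_ isT); rewrite ger0_norm; arithT.
apply: reach_trans (IH v _ Dv) _; first by move: un; rewrite -natr1; arithT.
by apply: jump_reach => //; arithT.
Qed.

End ExtractReach.

(** The flow after the last jump may last less than [T]; its time [s] is therefore kept apart from
    the chain. *)
Lemma pseudo_orbit_reach eps l gamma t : 0 < eps ->
  pseudo_orbit psi T eps l gamma -> 0 <= t < l ->
  exists s z, [/\ 0 <= s, z = gamma 0 \/ reach eps (gamma 0) z & gamma t = psi s z].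
Proof.
move=> eps0 po tl; have [D [finD DT Dsep Dcont Djump]] := po_jumps po.
have [->|t0] := eqVneq t 0.
  by exists 0, (gamma 0); split; rewrite ?flow0 //; left.
have [Dt|nDt] := pselect (D t).
  exists 0, (gamma t); split; rewrite ?flow0 //; right.
  exact: (@reach_jump_point eps l gamma _ po D).
have [|v [vt v0D noD]] := @previous_jump D t finD.
  by rewrite lt_neqAle eq_sym t0; case/andP: tl.
exists (t - v), (gamma v); split; first arithT.
  case: v0D => [->|Dv]; [by left|right].
  exact: (@reach_jump_point eps l gamma _ po D).
apply: (flow_off_jumps po Dcont) => //; [arithT..|] => w vw; rewrite le_eqVlt => /orP[/eqP->//|].
exact: noD.
Qed.

Lemma pseudo_orbit_end eps l gamma y : 0 < eps ->
  pseudo_orbit psi T eps l gamma -> gamma @ l^'- --> y ->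
  exists s z, [/\ 0 < s, z = gamma 0 \/ reach eps (gamma 0) z & y = psi s z].
Proof.
move=> eps0 po gy; have [D [finD DT Dsep Dcont Djump]] := po_jumps po.
have [v [vl v0D noD]] := @previous_jump D l finD (po_length po).
exists (l - v), (gamma v); split; first arithT.
  case: v0D => [->|Dv]; [by left|right].
  exact: (@reach_jump_point eps l gamma _ po D).
apply: left_cvg_unique gy _; apply: (left_limit_off_jumps po Dcont) => //; arithT.
Qed.

(** * From chains of jumps to pseudo-orbits *)

Lemma orbit_pseudo_orbit eps l x : 0 < l -> pseudo_orbit psi T eps l (psi ^~ x).
Proof.
move=> l0; split => // [t _||t s t0 ts sl _].
- exact: orbit_cvg_within.
- by exists set0; split => // t _ _; exact: orbit_cvg_within.
- by rewrite -flowD // subrK.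
Qed.

Definition orbit_cons (t : R) (x : N) (gamma : R -> N) (u : R) : N :=
  if u < t then psi u x else gamma (u - t).

Lemma orbit_cons_left t x gamma : orbit_cons t x gamma @ t^'- --> psi t x.
Proof.
apply/cvg_withinP => e /(orbit_near x t)[d d0 dP]; exists d => // w /= wt wd.
by rewrite /orbit_cons wt; exact: dP.
Qed.

(** At [u = t] the concatenation is in general continuous only from the right; the disjunction in
    the premises then asks [A] to lie to the right of [t]. *)
Lemma orbit_cons_shift t x gamma (A B : set R) u : t <= u ->
  (forall w, A w -> t <= w -> B (w - t)) -> (t < u \/ forall w, A w -> t <= w) ->
  gamma @ within B (nbhs (u - t)) --> gamma (u - t) ->
  orbit_cons t x gamma @ within A (nbhs u) --> orbit_cons t x gamma u.
Proof.
move=> tu AB tuA /cvg_withinP gu; apply/cvg_withinP => e /gu[d d0 dP].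
have [r r0 rP] : exists2 r : R, 0 < r & forall w, A w -> `|w - u| < r -> t <= w.
  case: tuA => [tu'|tA]; last by exists 1 => // w /tA.
  exists (u - t) => [|w _]; first by rewrite subr_gt0.
  by rewrite ltr_norml; arithT.
exists (Num.min d r) => [|w Aw]; first by rewrite lt_min d0.
rewrite lt_min => /andP[wd /(rP _ Aw) tw]; rewrite /orbit_cons (ltNge u) (ltNge w) tu tw /=.
apply: dP; [exact: AB|by move: wd; congr (`|_| < _); arithT].
Qed.

Lemma orbit_cons_shift_left t x gamma u z : t < u -> gamma @ (u - t)^'- --> z ->
  orbit_cons t x gamma @ u^'- --> z.
Proof.
move=> tu /cvg_withinP gz; apply/cvg_withinP => e /gz[d d0 dP].
exists (Num.min d (u - t)) => [|w /= wu]; first by rewrite lt_min d0 subr_gt0.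
rewrite lt_min => /andP[wd wt]; have tw : t <= w by move: wt; rewrite ltr_norml; arithT.
rewrite /orbit_cons (ltNge w) tw /=; apply: dP; first by rewrite /=; arithT.
by move: wd; congr (`|_| < _); arithT.
Qed.

Lemma orbit_cons_before t x gamma (A : set R) u : u < t ->
  orbit_cons t x gamma @ within A (nbhs u) --> orbit_cons t x gamma u.
Proof.
move=> ut; apply/cvg_withinP => e /(orbit_near x u)[d d0 dP].
exists (Num.min d (t - u)) => [|w _]; first by rewrite lt_min d0 subr_gt0.
rewrite lt_min => /andP[/dP wd wt]; rewrite /orbit_cons ut.
by have -> : w < t by move: wt; rewrite ltr_norml; arithT.
Qed.

(** The jumps of [gamma] are translated by [t], and [t] is added to them; it is far enough from the
    others because [gamma] has no jump before [T]. *)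
Lemma orbit_cons_pseudo_orbit eps l gamma t x : T <= t ->
  mdist (psi t x) (gamma 0) < eps -> pseudo_orbit psi T eps l gamma ->
  pseudo_orbit psi T eps (t + l) (orbit_cons t x gamma).
Proof.
move=> Tt xg po; have l0 := po_length po.
have [D [finD DT Dsep Dcont Djump]] := po_jumps po.
split => [|u ul||u s u0 us sl].
- arithT.
- have [ut|tu] := ltP u t; first exact: orbit_cons_before.
  apply: (@orbit_cons_shift _ _ _ _ [set w | u - t < w]) => //.
  + by move=> w /=; arithT.
  + by right => w; arithT.
  + by apply: (po_right_continuous po); arithT.
- exists (t |` [set u | D (u - t)]); split.
  + rewrite finite_setU; split=> //.
    have -> : [set u | D (u - t)] = (fun u => u + t) @` D.
      apply/seteqP; split => [u /= Du|_ [u Du <-] /=]; last by rewrite addrK.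
      by exists (u - t) => //; rewrite subrK.
    exact: finite_image.
  + by move=> u [->|/DT] /=; arithT.
  + move=> u v [->|Du] [->|Dv].
    * by rewrite eqxx.
    * by move=> _; rewrite distrC; apply: le_trans (ler_norm _); have /= := DT _ Dv; arithT.
    * by move=> _; apply: le_trans (ler_norm _); have /= := DT _ Du; arithT.
    * move=> uv; have := Dsep _ _ Du Dv; rewrite (inj_eq (addIr _)) uv => /(_ isT).
      by rewrite opprB addrA subrK.
  + move=> u ul nD; have [ut|tu] := ltP u t; first exact: orbit_cons_before.
    apply: (@orbit_cons_shift _ _ _ _ [set w | 0 <= w < l]) => //.
    * by move=> w /=; arithT.
    * left; rewrite lt_neqAle tu andbT; apply/eqP => tu'; apply: nD; left.
      by rewrite tu'.
    * by apply: Dcont; [arithT|move=> Du; apply: nD; right].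
  + move=> u [->|/= Du].
      exists (psi t x); first exact: orbit_cons_left.
      by rewrite /orbit_cons ltxx subrr metric_sym.
    have [z gz zu] := Djump _ Du; have /= Tul := DT _ Du.
    exists z; first by apply: orbit_cons_shift_left => //; arithT.
    by rewrite /orbit_cons (ltNge u) (_ : t <= u) //; arithT.
- have shift v : v < l -> {within [set w | u <= w <= v + t], continuous orbit_cons t x gamma} ->
    {within [set w | u - t <= w <= v /\ 0 <= w], continuous gamma}.
    move=> vl /continuous_withinP cont; apply/continuous_withinP => w /= [wuv w0].
    have /cont/cvg_withinP cw : u <= w + t <= v + t by arithT.
    apply/cvg_withinP => e /cw[d d0 dP]; exists d => // r [ruv r0] rw.
    have := dP (r + t); rewrite /orbit_cons (ltNge (w + t)) (ltNge (r + t)).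
    rewrite !lerDr r0 w0 /= !addrK; apply; first arithT.
    by move: rw; congr (`|_| < _); arithT.
  move=> cont; have [st|ts] := ltP s t.
    by rewrite /orbit_cons st (le_lt_trans us st) -flowD // subrK.
  have /shift : s - t < l by arithT.
  rewrite subrK => /(_ cont) cg; rewrite /orbit_cons (ltNge s) ts /=.
  have [ut|tu] := ltP u t; last first.
    rewrite (po_flow po (t := u - t)) ?subr_ge0 //; [by congr psi; arithT|arithT..|].
    have <- // : [set w | u - t <= w <= s - t /\ 0 <= w] = [set w | u - t <= w <= s - t].
    by apply/seteqP; split => w /=; [case|move=> wus; split; arithT].
  rewrite (po_flow po (t := 0)) ?subr_ge0 //; [|arithT|]; last first.
    have <- // : [set w | u - t <= w <= s - t /\ 0 <= w] = [set w | 0 <= w <= s - t].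
    by apply/seteqP; split => w /=; [case; arithT|move=> wus; split; arithT].
  (* Here [u < t <= s]. Continuity across [t] is possible although [t] counts as a jump; it forces
     the left limit [psi t x] to be [gamma 0], so that the two orbit pieces fit together. *)
  have -> : gamma 0 = psi t x; last by rewrite -!flowD //; congr psi; arithT.
  suff H : orbit_cons t x gamma @ t^'- --> gamma 0.
    exact: left_cvg_unique H (@orbit_cons_left t x gamma).
  have /continuous_withinP/(_ t) := cont; rewrite /= (ltW ut) ts => /(_ isT).
  rewrite {2}/orbit_cons ltxx subrr => /cvg_withinP ct; apply/cvg_withinP => e /ct[d d0 dP].
  exists (Num.min d (t - u)) => [|w /= wt]; first by rewrite lt_min d0 subr_gt0.
  rewrite lt_min => /andP[wd]; rewrite ltr_norml => wu; apply: dP wd => /=; arithT.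
Qed.

(** The last jump lands on [y], and a pseudo-orbit lives on a half-open interval: a positive time
    [s] of flow must follow for [y] to be one of its values. *)
Lemma reach_pseudo_orbit eps x y s : 0 < eps -> 0 < s -> reach eps x y ->
  exists l gamma, [/\ pseudo_orbit psi T eps l gamma, gamma 0 = x,
    exists2 t, 0 <= t < l & gamma t = y & gamma @ l^'- --> psi s y].
Proof.
move=> eps0 s0.
have cons y' t z w l gamma : T <= t -> mdist (psi t z) w < eps ->
    [/\ pseudo_orbit psi T eps l gamma, gamma 0 = w,
      exists2 t, 0 <= t < l & gamma t = y' & gamma @ l^'- --> psi s y'] ->
    exists l gamma, [/\ pseudo_orbit psi T eps l gamma, gamma 0 = z,
      exists2 t, 0 <= t < l & gamma t = y' & gamma @ l^'- --> psi s y'].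
  move=> Tt zw [po g0 [u ul gu] gl]; have l0 := po_length po.
  exists (t + l), (orbit_cons t z gamma); split.
  - by apply: orbit_cons_pseudo_orbit => //; rewrite g0.
  - by rewrite /orbit_cons (_ : 0 < t) ?flow0 //; arithT.
  - exists (t + u); first arithT.
    by rewrite /orbit_cons (ltNge (t + u)) lerDl (_ : 0 <= u) ?[t + u]addrC ?addrK //; arithT.
  - by apply: orbit_cons_shift_left; [arithT|rewrite [t + l]addrC addrK].
elim=> [{}x z [t /andP[Tt _] xz]|{}x z w [t /andP[Tt _] xz] _ [l [gamma IH]]].
  apply: (cons z t x z s (psi ^~ z) Tt xz); split.
  - exact: orbit_pseudo_orbit.
  - by rewrite flow0.
  - by exists 0; rewrite ?flow0 // lexx s0.
  - exact: orbit_cvg_within.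
exact: (cons _ _ _ _ _ _ Tt xz IH).
Qed.

Lemma leads_toP x y : leads_to psi T x y <->
  forall eps, 0 < eps -> exists s z, [/\ 0 < s, z = x \/ reach eps x z & y = psi s z].
Proof.
split=> [xy eps eps0|xy eps eps0].
  have [l [gamma [po <- gy]]] := xy eps eps0; exact: pseudo_orbit_end gy.
have [s [z [s0 [->|xz] ->]]] := xy eps eps0.
  exists s, (psi ^~ x); split; [exact: orbit_pseudo_orbit|by rewrite flow0|].
  exact: orbit_cvg_within.
by have [l [gamma [po g0 _ gs]]] := reach_pseudo_orbit eps0 s0 xz; exists l, gamma.
Qed.

End Reach.

(** * Uniformity on cocompact coverings *)

(* Compactness of the quotient of [X] by [act], without mentioning the quotient. *)
Definition uniform_principle (R : realType) (X : metricType R) (G : Type)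
    (act : G -> X -> X) : Prop :=
  forall P : R -> X -> Prop,
    (forall g e x, P e x -> P e (act g x)) ->
    (forall e d x, d <= e -> P e x -> P d x) ->
    (forall x, exists2 e, 0 < e & forall y, mdist x y < e -> P e y) ->
    exists2 e, 0 < e & forall x, P e x.

(** Near each point of [M] one [e] serves for whole fibres, since [pi] is open and [P] is invariant.
    Compactness is used in near-covering form, along positive [e] tending to 0. *)
Lemma compact_uniform_principle (R : realType) (M : topologicalType)
    (X : metricType R) (pi : X -> M) (G : Type) (act : G -> X -> X) :
  compact [set: M] -> (forall b, exists x, pi x = b) ->
  (forall x (A : set X), nbhs x A -> nbhs (pi x) (pi @` A)) ->
  (forall x y, pi x = pi y -> exists g, y = act g x) ->
  uniform_principle act.
Proof.
move=> /compact_near_coveringP cM pi_surj pi_open pi_fibre P Pact Ple Ploc.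
have /near_withinP[d d0 dP] : \forall e \near (0 : R)^'+, [set: M] `<=`
    (fun b => forall y, pi y = b -> P e y).
  apply: cM => b _; have [x <-] := pi_surj b; have [e e0 eP] := Ploc x.
  exists (pi @` [set y | mdist x y < e], [set d | d <= e]) => /=.
    split; first by apply/pi_open/near_mdistP; exists e.
    by apply/near_withinP; exists e => // w; rewrite subr0 => w0 /ltr_normlW/ltW.
  move=> [c w] /= [[y xy <-] we] z yz; have [g ->] := pi_fibre _ _ (esym yz).
  by apply/Pact/(Ple e) => //; exact: eP.
exists (d / 2) => [|x]; first by rewrite divr_gt0.
apply: (dP (d / 2) _ _ (pi x) I x erefl) => /=; first by rewrite divr_gt0.
by rewrite subr0 gtr0_norm ?divr_gt0 // gtr_pMr // invf_lt1 // ltr1n.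
Qed.

(** Near-covering compactness again, along the filter of lists growing by inclusion: near [pi x],
    every list containing [x] is good. *)
Lemma compact_finite_net (R : realType) (M : topologicalType)
    (X : metricType R) (pi : X -> M) (G : Type) (act : G -> X -> X) :
  compact [set: M] -> (forall b, exists x, pi x = b) ->
  (forall x (A : set X), nbhs x A -> nbhs (pi x) (pi @` A)) ->
  (forall x y, pi x = pi y -> exists g, y = act g x) ->
  forall r : R, 0 < r -> exists s : seq X, forall y, exists g c,
    c \in s /\ mdist c (act g y) < r.
Proof.
move=> /compact_near_coveringP cM pi_surj pi_open pi_fibre r r0.
pose F : set_system (seq X) :=
  filter_from [set: seq X] (fun s0 => [set s : seq X | {subset s0 <= s}]).
have FF : Filter F.
  apply: filter_from_filter => [|s1 s2 _ _]; first by exists [::].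
  exists (s1 ++ s2) => // s /= sub.
  by split=> c cs; apply: sub; rewrite mem_cat cs ?orbT.
have [s _ /(_ s)] : \near F, [set: M] `<=`
    (fun b => forall y, pi y = b -> exists g c, c \in F /\ mdist c (act g y) < r).
  apply: cM => b _; have [x <-] := pi_surj b.
  exists (pi @` [set y | mdist x y < r], [set s : seq X | {subset [:: x] <= s}]) => /=.
    by split; [apply/pi_open/near_mdistP; exists r|exists [:: x]].
  move=> [c s] /= [[y xy <-] xs] z yz; have [g zy] := pi_fibre _ _ yz.
  by exists g, x; rewrite -zy; split => //; apply: xs; rewrite mem_head.
by move=> /(_ (fun _ => id)) sP; exists s => y; exact: (sP (pi y)).
Qed.

Section Uniformity.
Variables (R : realType) (X : metricType R) (G : Type) (act : G -> X -> X).
Hypotheses (act_iso : forall g x y, mdist (act g x) (act g y) = mdist x y)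
  (act_onto : forall g y, exists x, act g x = y) (unif : uniform_principle act).

(** The index [s] allows one modulus for a whole range of flow times. Since [D s] behaves like a
    distance, halving radius and tolerance carries the local modulus at [x] to nearby points. *)
Lemma uniform_modulus (S : Type) (A : set S) (D : S -> X -> X -> R) :
  (forall s g x y, A s -> D s (act g x) (act g y) = D s x y) ->
  (forall s x y z, A s -> D s y z <= D s x y + D s x z) ->
  (forall x (e : R), 0 < e -> exists2 d, 0 < d &
     forall s y, A s -> mdist x y < d -> D s x y < e) ->
  forall e : R, 0 < e -> exists2 d, 0 < d &
    forall s x y, A s -> mdist x y < d -> D s x y < e.
Proof.
move=> Dact Dtri Dloc e e0.
have [|||d d0 dP] := unif (P := fun d x => forall s y, A s -> mdist x y < d -> D s x y < e).
- move=> g d x dP s y As; have [y' <-] := act_onto g y.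
  by rewrite act_iso Dact //; exact: dP.
- by move=> d d' x dd dP s y As xy; apply: dP => //; exact: lt_le_trans dd.
- move=> x; have [|d d0 dP] := Dloc x (e / 2); first by rewrite divr_gt0.
  exists (d / 2) => [|y xy s z As yz]; first by rewrite divr_gt0.
  rewrite (le_lt_trans (Dtri s x y z As)) // (splitr e) ltrD //; apply: dP => //.
    by arith.
  by apply: le_lt_trans (metric_triangle _ y _) _; arith.
- by exists d => // s x y; exact: dP.
Qed.

Lemma uniform_continuity (Y : metricType R) (f : X -> Y) :
  continuous f ->
  (forall g x y, mdist (f (act g x)) (f (act g y)) = mdist (f x) (f y)) ->
  forall e : R, 0 < e -> exists2 d, 0 < d &
    forall x y, mdist x y < d -> mdist (f x) (f y) < e.
Proof.
move=> fc fact e e0.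
have [|||d d0 dP] := @uniform_modulus unit setT (fun _ x y => mdist (f x) (f y)) _ _ _ e e0.
- by move=> _ g x y _; exact: fact.
- by move=> _ x y z _; rewrite [mdist (f x) (f y)]metric_sym metric_triangle.
- move=> x e' e'0; have /metricType_numDomainType.cvgrPdist_lt/(_ e' e'0) := fc x.
  by move=> /near_mdistP[d d0 dP]; exists d => // _ y _; exact: dP.
- by exists d => // x y; exact: (dP tt).
Qed.

Lemma real_continuity (f : X -> R) x (e : R) : continuous f -> 0 < e ->
  exists2 d, 0 < d & forall y, mdist x y < d -> `|f x - f y| < e.
Proof.
move=> fc e0; have /cvgrPdist_lt/(_ e e0)/near_mdistP[d d0 dP] := fc x.
by exists d.
Qed.

(** Only differences of values have to be invariant, so equivariant functions qualify. *)
Lemma real_uniform_continuity (f : X -> R) :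
  continuous f ->
  (forall g x y, f (act g x) - f (act g y) = f x - f y) ->
  forall e : R, 0 < e -> exists2 d, 0 < d &
    forall x y, mdist x y < d -> `|f x - f y| < e.
Proof.
move=> fc fact e e0.
have [|||d d0 dP] := @uniform_modulus unit setT (fun _ x y => `|f x - f y|) _ _ _ e e0.
- by move=> _ g x y _; rewrite fact.
- by move=> _ x y z _; rewrite -[`|f x - f y|]distrC; exact: ler_distD.
- move=> x e' e'0; have [d d0 dP] := real_continuity x fc e'0.
  by exists d => // _ y _; exact: dP.
- by exists d => // x y; exact: (dP tt).
Qed.

Lemma invariant_bounded (f : X -> R) : continuous f ->
  (forall g x, f (act g x) = f x) -> exists2 B, 0 <= B & forall x, `|f x| <= B.
Proof.
move=> fc fact.
(* The principle produces small numbers, so the bound on [|f x|] is sought as the inverse of one. *)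
have [|||e e0 eP] := unif (P := fun e x => e * `|f x| <= 1).
- by move=> g e x; rewrite fact.
- move=> e d x de; apply: le_trans; exact: ler_wpM2r.
- move=> x; have [d d0 dP] := real_continuity x fc ltr01.
  have f1 : 0 < `|f x| + 1 by rewrite ltr_wpDl.
  exists (Num.min d (`|f x| + 1)^-1) => [|y]; first by rewrite lt_min d0 invr_gt0.
  rewrite lt_min => /andP[/dP xy _].
  have fy : `|f y| <= `|f x| + 1.
    by have := ler_distD (f x) (f y) 0; rewrite !subr0 distrC; arith.
  apply: le_trans (_ : (`|f x| + 1)^-1 * `|f y| <= 1).
    by rewrite ler_wpM2r // ge_min lexx orbT.
  by rewrite mulrC ler_pdivrMr // mul1r.
- exists e^-1 => [|x]; first by rewrite invr_ge0 ltW.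
  by rewrite -[e^-1]mul1r ler_pdivlMr // mulrC; exact: eP.
Qed.

End Uniformity.

Section FlowContinuity.
Variables (R : realType) (X : metricType R) (psi : R -> X -> X).
Hypothesis psi_flow : is_flow psi.

Lemma flow_joint (x : X) (t e : R) : 0 < e -> exists2 d : R, 0 < d &
  forall s y, `|s - t| < d -> mdist x y < d -> mdist (psi t x) (psi s y) < e.
Proof.
move=> e0; have := @flow_continuous _ _ _ psi_flow (t, x).
move=> /metricType_numDomainType.cvgrPdist_lt/(_ e e0)[[A B] /= [At Bx] AB].
have /nbhs_ballP[a /= a0 aA] := At; have /near_mdistP[b b0 bB] := Bx.
exists (Num.min a b) => [|s y]; first by rewrite lt_min a0.
rewrite !lt_min => /andP[sa _] /andP[_ yb]; apply: (AB (s, y)); split => /=.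
  by apply: aA; rewrite /ball /= distrC.
exact: bB.
Qed.

Lemma flow_equicontinuous (x : X) (a e : R) : 0 < e -> exists2 d : R, 0 < d &
  forall t y, `|t| <= a -> mdist x y < d -> mdist (psi t x) (psi t y) < e.
Proof.
move=> e0; have /compact_near_coveringP cK := @segment_compact R (- a) a.
have /near_mdistP[d d0 dP] : \forall y \near x, `[- a, a]%classic `<=`
    (fun t => mdist (psi t x) (psi t y) < e).
  apply: cK => t _; have [|d d0 dP] := @flow_joint x t (e / 2); first by rewrite divr_gt0.
  exists (ball t d, [set y | mdist x y < d]) => /=.
    by split; [exact: nbhsx_ballx|apply/near_mdistP; exists d].
  move=> [s y] /= [st xy]; rewrite (splitr e).
  apply: le_lt_trans (metric_triangle _ (psi t x) _) _; rewrite ltrD //.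
    by rewrite metric_sym; apply: dP; rewrite ?mdistxx // distrC.
  by apply: dP => //; rewrite distrC.
exists d => // t y ta xy; apply: (dP y) => //=.
by rewrite in_itv /= -ler_norml.
Qed.

End FlowContinuity.

(** All that the dynamics needs from the infinite cyclic covering; the coverings themselves come
    back only at the end. *)
Record Z_cover_flow (R : realType) (X : metricType R) (psi : R -> X -> X)
    (deck : int -> X -> X) : Prop := {
  zflow : is_flow psi;
  deck_iso : forall k x y, mdist (deck k x) (deck k y) = mdist x y;
  deck0 : forall x, deck 0 x = x;
  deckD : forall k l x, deck (k + l) x = deck k (deck l x);
  deck_flow : forall k t x, psi t (deck k x) = deck k (psi t x);
  deck_discrete : exists2 r : R, 0 < r &
    forall k x, mdist x (deck k x) < r -> k = 0;
  deck_uniform : uniform_principle deck;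
  deck_net : forall r : R, 0 < r -> exists s : seq X, forall y, exists k c,
    c \in s /\ mdist c (deck k y) < r
}.

(** * Chain recurrence on an infinite cyclic covering *)

Section Chains.
Variables (R : realType) (X : metricType R) (psi : R -> X -> X).
Variables (deck : int -> X -> X) (T : R).
Hypotheses (sys : Z_cover_flow psi deck) (T_gt0 : 0 < T).
Let psi_flow := zflow sys.
Let reach := @reach R X psi T.
Ltac arithT := have := T_gt0; arith.
Implicit Types (eps e d t s u v : R) (x y z w : X) (k l : int).

Lemma deckK k : cancel (deck k) (deck (- k)).
Proof. by move=> x; rewrite -(deckD sys) addNr (deck0 sys). Qed.

Lemma deckNK k : cancel (deck (- k)) (deck k).
Proof. by move=> x; rewrite -(deckD sys) addrN (deck0 sys). Qed.

Lemma deck_onto k y : exists x, deck k x = y.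
Proof. by exists (deck (- k) y); rewrite deckNK. Qed.

Lemma flow_uniform (a e : R) : 0 < e -> exists2 d, 0 < d &
  forall t x y, `|t| <= a -> mdist x y < d -> mdist (psi t x) (psi t y) < e.
Proof.
apply: (uniform_modulus (deck_iso sys) deck_onto (deck_uniform sys)
  (A := [set t | `|t| <= a])).
- by move=> t k x y _; rewrite !(deck_flow sys) (deck_iso sys).
- by move=> t x y z _; rewrite [mdist (psi t x) (psi t y)]metric_sym metric_triangle.
- by move=> x e' e'0; exact: flow_equicontinuous.
Qed.

Lemma flow_small_time e : 0 < e -> exists2 d, 0 < d &
  forall t x, `|t| < d -> mdist (psi t x) x < e.
Proof.
move=> e0; have [|||d d0 dP] := deck_uniform sys
  (P := fun d x => forall t, `|t| < d -> mdist (psi t x) x < e).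
- by move=> k d x dP t td; rewrite (deck_flow sys) (deck_iso sys); exact: dP.
- by move=> d d' x d'd dP t td; apply: dP; exact: lt_le_trans d'd.
- move=> x; have [|d d0 dP] := flow_joint psi_flow x 0 (e := e / 2); first by rewrite divr_gt0.
  exists (Num.min d (e / 2)) => [|y]; first by rewrite lt_min d0 divr_gt0.
  rewrite lt_min => /andP[xy xy'] t; rewrite lt_min => /andP[td _].
  rewrite (splitr e); apply: le_lt_trans (metric_triangle _ x _) _; rewrite ltrD //.
  by rewrite metric_sym -{1}(flow0 psi_flow x); apply: dP; rewrite ?subr0.
- by exists d => // t x; exact: dP.
Qed.

Lemma reach_deck eps k x y : reach eps x y -> reach eps (deck k x) (deck k y).
Proof.
have J z w : jump psi T eps z w -> jump psi T eps (deck k z) (deck k w).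
  by move=> [t tT zw]; exists t => //; rewrite (deck_flow sys) (deck_iso sys).
elim=> [{}x {}y /J|{}x {}y z /J xy _ IH]; first exact: reach_jump.
exact: reach_cons xy IH.
Qed.

Lemma reach_flow0 eps x t : 0 < eps -> T <= t -> reach eps x (psi t x).
Proof. by move=> e0 Tt; apply: (reach_flow psi_flow T_gt0 e0 Tt); rewrite mdistxx. Qed.

Lemma reach_end_near eps e x y y' :
  mdist y y' < e -> reach eps x y -> reach (eps + e) x y'.
Proof.
move=> yy xy; elim: xy yy => [{}x {}y [t tT xy]|{}x {}y z [t tT xy] _ IH] yy.
  apply: reach_jump; exists t => //.
  by apply: le_lt_trans (metric_triangle _ y _) _; rewrite ltrD.
apply: reach_cons (IH yy); exists t => //; apply: lt_le_trans xy _.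
by rewrite lerDl; apply: le_trans (ltW yy); exact: mdist_ge0.
Qed.

(** Only the first jump sees the starting point. *)
Lemma reach_start_near eps e x x' y :
  (forall t, T <= t <= 2 * T -> mdist (psi t x) (psi t x') < e) ->
  reach eps x y -> reach (eps + e) x' y.
Proof.
move=> xx xy.
have e0 : 0 <= e by apply/ltW/(le_lt_trans (mdist_ge0 _ _) (xx T _)); arithT.
have J z : jump psi T eps x z -> jump psi T (eps + e) x' z.
  move=> [t tT xz]; exists t => //; rewrite addrC.
  by apply: le_lt_trans (metric_triangle _ (psi t x) _) _; rewrite ltrD // metric_sym xx.
have [/J|[z /J xz zy]] := reach_inv xy; first exact: reach_jump.
by apply: reach_cons xz _; apply: reach_le zy; rewrite lerDl.
Qed.

Lemma reach_perturb eps : 0 < eps -> exists2 d, 0 < d &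
  forall x x' y y', mdist x x' < d -> mdist y y' < d ->
  reach (eps / 2) x y -> reach eps x' y'.
Proof.
move=> e0; have [|d d0 dP] := @flow_uniform (2 * T) (eps / 4); first by rewrite divr_gt0.
exists (Num.min d (eps / 4)) => [|x x' y y']; first by rewrite lt_min d0 divr_gt0.
rewrite !lt_min => /andP[xx _] /andP[_ yy] xy.
have -> : eps = eps / 2 + eps / 4 + eps / 4 by arith.
apply: reach_end_near yy _; apply: reach_start_near xy => t tT.
by apply: dP => //; rewrite ger0_norm; arithT.
Qed.

(** A flow time [s >= T] is one more exact chain. A shorter one is added to the flow time of the
    last jump, whose error is controlled by uniform continuity of the flow up to time [T]. *)
Lemma reach_extend eps : 0 < eps -> exists2 d, 0 < d &
  forall x z s, 0 <= s -> reach d x z -> reach eps x (psi s z).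
Proof.
move=> e0; have [d d0 dP] := @flow_uniform T eps e0.
exists (Num.min d eps) => [|x z s s0 xz]; first by rewrite lt_min d0.
have le_eps : Num.min d eps <= eps by rewrite ge_min lexx orbT.
have [Ts|sT] := leP T s.
  by apply: reach_trans (reach_le le_eps xz) _; exact: reach_flow0.
elim: xz => [{}x {}z [t tT xz]|{}x {}z w xz _ IH].
  apply: (@reach_flow _ _ _ _ psi_flow T_gt0 _ (s + t)) => //; first by arithT.
  rewrite (flowD psi_flow); apply: dP; first by rewrite ger0_norm //; arith.
  by apply: lt_le_trans xz _; rewrite ge_min lexx.
by apply: reach_cons IH; apply: jump_le xz.
Qed.

(** The first two jumps are merged: their flow times add up to at least [2 * T], which leaves at
    least [T] once [t] is removed. A chain of a single jump is run twice. *)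
Lemma reach_skip eps : 0 < eps -> exists2 d, 0 < d &
  forall x t, 0 <= t <= T -> reach d x x -> reach eps (psi t x) x.
Proof.
move=> e0; have [|d0 d00 dP] := @flow_uniform (2 * T) (eps / 2); first by rewrite divr_gt0.
pose d := Num.min d0 (eps / 2).
have d_eps : d <= eps by rewrite ge_min; apply/orP; right; arith.
exists d => [|x t tT xx]; first by rewrite lt_min d00 divr_gt0.
have two y w : jump psi T d x y -> jump psi T d y w -> reach eps (psi t x) w.
  move=> [u uT]; rewrite lt_min => /andP[xy _] [v vT]; rewrite lt_min => /andP[_ yw].
  apply: (@reach_flow _ _ _ _ psi_flow T_gt0 _ (v + u - t)) => //; first by arithT.
  rewrite -(flowD psi_flow) subrK (flowD psi_flow) (splitr eps).
  apply: le_lt_trans (metric_triangle _ (psi v y) _) _; rewrite ltrD //.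
  by apply: dP => //; rewrite ger0_norm; arithT.
have [y xy yx] : exists2 y, jump psi T d x y & reach d y x.
  by have [xy|//] := reach_inv xx; exists x.
have [/(two _ _ xy)//|[z yz zx]] := reach_inv yx.
by apply: reach_trans (two _ _ xy yz) _; apply: reach_le zx.
Qed.

(** Unlike [leads_to], this allows no free piece of flow at the end; both relations agree when [x]
    is recurrent. *)
Definition chains x y := forall eps, 0 < eps -> reach eps x y.

Lemma chains_trans y x z : chains x y -> chains y z -> chains x z.
Proof. by move=> xy yz e e0; apply: reach_trans (xy e e0) (yz e e0). Qed.

Lemma chains_extend x z s : 0 <= s -> chains x z -> chains x (psi s z).
Proof. by move=> s0 xz e /reach_extend[d d0]; apply => //; exact: xz. Qed.

Lemma chains_skip x t : 0 <= t <= T -> chains x x -> chains (psi t x) x.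
Proof. by move=> tT xx e /reach_skip[d d0]; apply => //; exact: xx. Qed.

Lemma chains_flow x t : T <= t -> chains x (psi t x).
Proof. by move=> Tt e e0; exact: reach_flow0. Qed.

Lemma chains_skip_all x t : 0 <= t -> chains x x -> chains (psi t x) x.
Proof.
move=> t0; have [n tn] : exists n : nat, t < n%:R * T.
  exists (Num.truncn (t / T)).+1; rewrite -ltr_pdivrMr //; exact: truncnS_gt.
elim: n t x t0 tn => [|n IH] t x t0 tn xx; first by exfalso; move: tn; rewrite mul0r; arith.
have [tT|Tt] := leP t T; first by apply: chains_skip => //; rewrite t0.
have xT : chains (psi T x) x by apply: chains_skip => //; rewrite lexx ltW.
apply: (chains_trans _ xT); rewrite -(subrK T t) (flowD psi_flow).
apply: IH; [arith|by move: tn; rewrite -natr1; arith|].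
by apply: (chains_trans xT); apply: chains_flow.
Qed.

Lemma reach_shift s eps : 0 < eps -> exists2 d, 0 < d &
  forall x y, reach d x y -> reach eps (psi s x) (psi s y).
Proof.
move=> e0; have [d d0 dP] := @flow_uniform `|s| eps e0; exists d => // x y.
have J z w : jump psi T d z w -> jump psi T eps (psi s z) (psi s w).
  move=> [t tT zw]; exists t => //.
  by rewrite -(flowD psi_flow) addrC (flowD psi_flow); exact: dP.
elim=> [{}x {}y /J|{}x {}y z /J xy _ IH]; first exact: reach_jump.
exact: reach_cons xy IH.
Qed.

Lemma chains_shift s x y : chains x y -> chains (psi s x) (psi s y).
Proof. by move=> xy e /(reach_shift s)[d d0]; apply; exact: xy. Qed.

(** The chain is redirected to a point slightly before [y] on its orbit, and the positive flow time
    that ends a pseudo-orbit leads from there to [y]. *)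
Lemma chains_leads_to x y : chains x y -> leads_to psi T x y.
Proof.
move=> xy; apply/(leads_toP psi_flow T_gt0) => eps e0.
have [|d d0 dP] := @flow_small_time (eps / 2); first by rewrite divr_gt0.
exists (d / 2), (psi (- (d / 2)) y); split; first by rewrite divr_gt0.
  right; rewrite (splitr eps).
  apply: (@reach_end_near _ _ _ y); last by apply: xy; rewrite divr_gt0.
  by rewrite metric_sym; apply: dP; rewrite normrN gtr0_norm; arith.
by rewrite -(flowD psi_flow) addrN flow0.
Qed.

(** A pseudo-orbit without jumps from [x] to [x] makes [x] periodic, and enough periods last at
    least [T]. If [x] is not periodic there is always a jump, and the final flow is absorbed by
    [reach_extend]. *)
Lemma recurrent_chains x : recurrent psi T x <-> chains x x.
Proof.
split=> [/(leads_toP psi_flow T_gt0) xx|]; last exact: chains_leads_to.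
have [per|nper] := pselect (exists2 s, 0 < s & x = psi s x).
  have [s s0 sx] := per.
  have sn m : x = psi (m%:R * s) x.
    elim: m => [|m IH]; first by rewrite mul0r flow0.
    by rewrite -natr1 mulrDl mul1r (flowD psi_flow) -sx.
  rewrite {2}(sn (Num.truncn (T / s)).+1); apply: chains_flow.
  by rewrite -ler_pdivrMr // ltW // truncnS_gt.
move=> eps /reach_extend[d d0 dP]; have [s [z [s0 zx xs]]] := xx d d0.
rewrite {2}xs; apply: dP; first exact: ltW.
by case: zx => // zx; case: nper; exists s => //; rewrite {1}xs zx.
Qed.

Lemma recurrent_leads_to x y : chains x x -> leads_to psi T x y <-> chains x y.
Proof.
move=> xx; split=> [|]; last exact: chains_leads_to.
move=> /(leads_toP psi_flow T_gt0) xy eps /reach_extend[d d0 dP].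
have [s [z [s0 zx ->]]] := xy d d0; apply: dP; first exact: ltW.
by case: zx => [->|//]; exact: xx.
Qed.

Definition chain_class x : set X := [set y | chains x y /\ chains y x].

Lemma recurrence_chainP (K : set X) : recurrence_chain psi T K <->
  exists2 x, chains x x & K = chain_class x.
Proof.
have E x : chains x x -> [set y | recurrent psi T y /\
    leads_to psi T x y /\ leads_to psi T y x] = chain_class x.
  move=> xx; apply/seteqP; split => y.
    move=> [/recurrent_chains yy [/(recurrent_leads_to _ xx) xy]].
    by move=> /(recurrent_leads_to _ yy).
  move=> [xy yx]; have yy := chains_trans yx xy.
  split; first exact/recurrent_chains.
  by split; [exact/(recurrent_leads_to _ xx)|exact/(recurrent_leads_to _ yy)].
split=> -[x xx ->].
  by have /recurrent_chains xx' := xx; exists x => //; exact: E.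
by exists x; [exact/recurrent_chains|rewrite E].
Qed.

Lemma nonincreasing_flow (f : X -> R) :
  (forall x t, 0 <= t <= T -> f (psi t x) <= f x) ->
  forall x t, 0 <= t -> f (psi t x) <= f x.
Proof.
move=> fT x t t0; have [n tn] : exists n : nat, t < n%:R * T.
  exists (Num.truncn (t / T)).+1; rewrite -ltr_pdivrMr //; exact: truncnS_gt.
elim: n t x t0 tn => [|n IH] t x t0 tn; first by exfalso; move: tn; rewrite mul0r; arith.
have [tT|Tt] := leP t T; first by apply: fT; rewrite t0.
apply: le_trans (_ : f (psi T x) <= _); last by apply: fT; arithT.
by rewrite -{1}(subrK T t) (flowD psi_flow); apply: IH; [|move: tn; rewrite -natr1]; arith.
Qed.

End Chains.

(** * From Lyapunov maps to bounded chains *)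

Section RealLine.
Variable R : realType.

Lemma floorD1 (x : R) : x < (Num.floor x)%:~R + 1.
Proof. by rewrite -[X in _ + X]/(1%:~R) -intrD; exact: floorD1_gt. Qed.

Lemma int_close (k l : int) : `|k%:~R - l%:~R : R| < 1 -> k = l.
Proof.
rewrite -intrB -intr_norm -[X in _ < X]/(1%:~R) ltr_int => kl.
by apply/eqP; rewrite -subr_eq0 -normr_eq0; apply/eqP; lia.
Qed.

Lemma int_ltD1 (k l : int) : (k%:~R < l%:~R + 1 :> R) = (k <= l).
Proof. by rewrite -[X in _ + X]/(1%:~R) -intrD ltr_int ltzD1. Qed.

Lemma real_locally_constant (B : set R) a b :
  (forall t, exists2 d : R, 0 < d & forall s, `|s - t| < d -> B s <-> B t) ->
  B a -> B b.
Proof.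
move=> Bloc Ba; suff -> : B = [set: R] by [].
have /connected_intervalP cR : is_interval [set: R] by [].
have openB (D : set R) : (forall t s, (B s <-> B t) -> D s <-> D t) -> open D.
  move=> BD; rewrite openE => t Dt; have [d d0 dB] := Bloc t.
  apply/nbhs_ballP; exists d => // s; rewrite /ball /= distrC => /dB/BD st.
  exact/st.
apply: cR; [by exists a|exists B|exists B]; rewrite ?setTI //.
  exact: openB.
rewrite -[B]setCK closedC; apply: openB => t s st.
by split=> nB /st.
Qed.

End RealLine.

Section Necessity.
Variables (R : realType) (X : metricType R) (psi : R -> X -> X).
Variables (deck : int -> X -> X) (T : R).
Hypotheses (sys : Z_cover_flow psi deck) (T_gt0 : 0 < T).
Let psi_flow := zflow sys.
Ltac arithT := have := T_gt0; arith.
Implicit Types (eps e d t s u v : R) (x y z w : X) (k l : int).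

Variable h : X -> R.
Hypotheses (h_eq : Z_equivariant deck h) (h_lyap : lyapunov psi T h).
Local Notation reach := (reach psi T).
Local Notation chains := (chains psi T).

Lemma chains_deck k x y : chains x y -> chains (deck k x) (deck k y).
Proof. by move=> xy e e0; apply: reach_deck => //; exact: xy. Qed.

Lemma lyapunov_chains x y : chains x y -> chains y x -> h x = h y.
Proof.
move=> xy yx; have xx := chains_trans xy yx.
apply: (lyapunov_constant h_lyap (K := chain_class psi T x)); last by split.
  by apply/(recurrence_chainP sys T_gt0); exists x.
by split.
Qed.

Lemma lyapunov_eq x y : chains x x -> chains y y -> h x = h y ->
  chains x y /\ chains y x.
Proof.
move=> xx yy xy; have [//|nxy] := pselect (chains x y /\ chains y x).
have rc z : chains z z -> recurrence_chain psi T (chain_class psi T z).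
  by move=> zz; apply/(recurrence_chainP sys T_gt0); exists z.
case: (lyapunov_distinct h_lyap (rc _ xx) (rc _ yy) _ _ _ xy).
- by move=> E; apply: nxy; have [] : chain_class psi T x y by rewrite E.
- by split.
- by split.
Qed.

Lemma lyapunov_nonincreasing x t : 0 <= t -> h (psi t x) <= h x.
Proof.
apply: (nonincreasing_flow sys T_gt0) => {}x {}t tT.
have [xx|nxx] := pselect (chains x x).
  rewrite (@lyapunov_chains (psi t x) x) //; first exact: (chains_skip sys T_gt0).
  by apply: (chains_extend sys T_gt0) => //; case/andP: tT.
have [->|t0] := eqVneq t 0; first by rewrite flow0.
apply/ltW/(lyapunov_decreasing h_lyap); first by move/(recurrent_chains sys T_gt0).
by rewrite lt_neqAle eq_sym t0; case/andP: tT.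
Qed.

(** * Recurrent points cannot occupy every level *)

Section AllValuesCritical.
Variable xc : R -> X.
Hypotheses (h_xc : forall c, h (xc c) = c) (xc_rec : forall c, chains (xc c) (xc c)).

(** The claim is extended to all recurrent [y] with level near [c + k], for all integers [k]: in
    this form it is invariant under the deck group and can be checked locally. *)
Lemma critical_link eps c : 0 < eps -> exists2 d, 0 < d &
  forall c', `|c' - c| < d -> reach eps (xc c) (xc c') /\ reach eps (xc c') (xc c).
Proof.
move=> eps0.
have [|||d d0 dP] := deck_uniform sys (P := fun d y => chains y y ->
    forall k, `|h y - c - k%:~R| < d ->
    reach eps y (deck k (xc c)) /\ reach eps (deck k (xc c)) y).
- move=> k d x dP /(chains_deck (- k)); rewrite !(deckK sys) => /dP{}dP l.
  rewrite h_eq => dl; have [|xk kx] := dP (l - k).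
    by move: dl; congr (`|_| < _); rewrite intrB; arith.
  have -> : l = k + (l - k) by rewrite addrC subrK.
  by rewrite (deckD sys); split; exact: reach_deck.
- by move=> e d x de xP xx k xk; apply: xP => //; exact: lt_le_trans de.
- move=> z; have [zz|nzz] := pselect (chains z z); last first.
    (* A recurrent point close enough to [z] would give [reach e z z]: near [z] there is nothing to
       prove. *)
    have [e [e0 nz]] : exists e, 0 < e /\ ~ reach e z z.
      apply: contrapT => H; apply: nzz => e e0; apply: contrapT => nz.
      by apply: H; exists e.
    have [d d0 dP] := reach_perturb sys T_gt0 e0.
    exists d => // y zy yy; case: nz; apply: (dP y z y z); rewrite 1?metric_sym //.
    by apply: yy; rewrite divr_gt0.
  have [[k hk]|nk] := pselect (exists k, h z = c + k%:~R).
    have [zk kz] : chains z (deck k (xc c)) /\ chains (deck k (xc c)) z.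
      apply: lyapunov_eq => //; first exact: chains_deck.
      by rewrite h_eq h_xc hk.
    have [d d0 dP] := reach_perturb sys T_gt0 eps0.
    have [|d1 d10 d1P] := real_continuity z (lyapunov_continuous h_lyap) (e := 1 / 4).
      by rewrite divr_gt0.
    exists (Num.min d (Num.min d1 (1 / 4))) => [|y].
      by rewrite !lt_min d0 d10 divr_gt0.
    rewrite !lt_min => /and3P[zy /d1P hzy _] yy l; rewrite !lt_min => /and3P[_ _ hl].
    have -> : l = k.
      apply/esym/(@int_close R); move: hl hzy; rewrite hk !ltr_norml; arith.
    have eps2 : 0 < eps / 2 by rewrite divr_gt0.
    split; first by apply: (dP z y (deck k (xc c)) _ zy _ (zk _ eps2)); rewrite mdistxx.
    by apply: (dP (deck k (xc c)) _ z y _ zy (kz _ eps2)); rewrite mdistxx.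
  (* Now [h z] lies strictly between [c + k] and [c + k + 1], at distance [e] from the nearer one:
     no level near [h z] is close to some [c + l]. *)
  pose k := Num.floor (h z - c); pose e := Num.min (h z - c - k%:~R) (c + k%:~R + 1 - h z).
  have e0 : 0 < e.
    rewrite lt_min subr_gt0 lt_neqAle floor_le andbT; apply/andP; split.
      by apply/eqP => E; apply: nk; exists k; rewrite E; arith.
    by have := floorD1 (h z - c); rewrite -/k; arith.
  have [|d1 d10 d1P] := real_continuity z (lyapunov_continuous h_lyap) (e := e / 2).
    by rewrite divr_gt0.
  exists (Num.min d1 (e / 2)) => [|y]; first by rewrite lt_min d10 divr_gt0.
  rewrite lt_min => /andP[/d1P hzy _] _ l; rewrite lt_min => /andP[_ hl]; exfalso.
  have [el er] : e <= h z - c - k%:~R /\ e <= c + k%:~R + 1 - h z.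
    by rewrite !ge_min !lexx orbT.
  have [lk|kl] := leP l k.
    have : l%:~R <= k%:~R :> R by rewrite ler_int.
    by move: hl hzy; rewrite !ltr_norml; arith.
  have : k%:~R + 1 <= l%:~R :> R by rewrite -[X in _ + X]/(1%:~R) -intrD ler_int lezD1.
  by move: hl hzy; rewrite !ltr_norml; arith.
exists d => // c' cc'; have [|] := dP (xc c') (xc_rec c') 0; last by rewrite (deck0 sys).
by rewrite h_xc subr0.
Qed.

Lemma critical_values_false : False.
Proof.
suff H : chains (xc 0) (xc 1) /\ chains (xc 1) (xc 0).
  by have := lyapunov_chains H.1 H.2; rewrite !h_xc; arith.
have link eps : 0 < eps -> reach eps (xc 0) (xc 1) /\ reach eps (xc 1) (xc 0).
  move=> eps0; pose B c := reach eps (xc 0) (xc c) /\ reach eps (xc c) (xc 0).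
  apply: (@real_locally_constant _ B 0); last by split; exact: xc_rec.
  move=> t; have [d d0 dP] := critical_link t eps0; exists d => // s /dP[ts st].
  by split=> -[a b]; split; apply: reach_trans a _ || apply: reach_trans b.
by split=> e /link[].
Qed.

End AllValuesCritical.

Lemma regular_value : exists c, forall x, h x = c -> ~ chains x x.
Proof.
apply: contrapT => H.
have /choice[xc xcP] : forall c, exists x, h x = c /\ chains x x.
  move=> c; apply: contrapT => nc; apply: H; exists c => x hx xx.
  by apply: nc; exists x.
exact: (@critical_values_false xc (fun c => (xcP c).1) (fun c => (xcP c).2)).
Qed.

Lemma regular_barrier : exists c, exists2 e, 0 < e &
  forall x k, h x <= c + k%:~R -> h (psi T x) <= c + k%:~R - e.
Proof.
have [c creg] := regular_value; exists c.
have hc := lyapunov_continuous h_lyap.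
have [|||e e0 eP] := deck_uniform sys (P := fun e x => forall k,
    h x <= c + k%:~R -> h (psi T x) <= c + k%:~R - e); last by exists e.
- move=> k e x eP l; rewrite (deck_flow sys) !h_eq => hl.
  by have := eP (l - k); rewrite intrB; arith.
- by move=> e d x de xP k /xP; arith.
(* This is the least [k] with [h x <= c + k]; for [y] near [x] only the levels [c + l] with [l >= k]
   lie above [h y]. If [h x = c + k], the drop is strict because [x] is not recurrent. *)
- move=> x; pose k := - Num.floor (c - h x).
  have hk : h x <= c + k%:~R by have := floor_le (c - h x); rewrite /k intrN; arith.
  have kh : c + k%:~R - 1 < h x by have := floorD1 (c - h x); rewrite /k intrN; arith.
  have hT : h (psi T x) < c + k%:~R.
    move: hk; rewrite le_eqVlt => /orP[/eqP E|]; last first.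
      by apply: le_lt_trans; apply: lyapunov_nonincreasing; exact: ltW.
    rewrite -E; apply: (lyapunov_decreasing h_lyap) => // /(recurrent_chains sys T_gt0) xx.
    apply: (creg (deck (- k) x)); last exact: chains_deck.
    by rewrite h_eq intrN E; arith.
  have [|d1 d10 d1P] := real_continuity x hc (e := h x - (c + k%:~R - 1)); first by rewrite subr_gt0.
  pose e := (c + k%:~R - h (psi T x)) / 2.
  have e0 : 0 < e by rewrite divr_gt0 // subr_gt0.
  have [|d2 d20 d2P] := real_continuity (psi T x) hc (e := e) => //.
  have [d3 d30 d3P] := flow_uniform sys T d20.
  exists (Num.min d1 (Num.min d3 e)) => [|y]; first by rewrite !lt_min d10 d30.
  rewrite !lt_min => /and3P[/d1P hxy xy _] l hl.
  have kl : k <= l.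
    by rewrite -(@int_ltD1 R); move: hxy; rewrite ltr_norml; arith.
  have {}kl : k%:~R <= l%:~R :> R by rewrite ler_int.
  have : `|h (psi T x) - h (psi T y)| < e.
    by apply/d2P/d3P => //; rewrite gtr0_norm.
  have : Num.min d1 (Num.min d3 e) <= e by rewrite !ge_min lexx !orbT.
  by rewrite ltr_norml /e; arith.
Qed.

(** Jumps below the modulus of [h] for [e] do not undo the drop at a barrier [c + k], and the lowest
    barrier above [h x] is less than [h x + 1]. *)
Theorem lyapunov_reach_bound : exists2 eps, 0 < eps &
  forall x y, reach eps x y -> h y <= h x + 1.
Proof.
have [c [e e0 eP]] := regular_barrier; have hc := lyapunov_continuous h_lyap.
have [|d d0 dP] := real_uniform_continuity (deck_iso sys) (deck_onto sys)
    (deck_uniform sys) hc (e := e) _ e0.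
  by move=> k x y; rewrite !h_eq; arith.
exists d => // x y xy.
have below k : h x <= c + k%:~R -> h y <= c + k%:~R.
  have J z w : jump psi T d z w -> h z <= c + k%:~R -> h w <= c + k%:~R.
    move=> [t /andP[Tt _] /dP zw] /eP zT; move: zw; rewrite ltr_norml.
    have := lyapunov_nonincreasing (psi T z) (t := t - T).
    by rewrite -(flowD psi_flow) subrK subr_ge0 => /(_ Tt); arith.
  by elim: xy => [{}x {}y /J//|{}x {}y z /J xy _ IH hx]; apply/IH/xy.
pose k := - Num.floor (c - h x).
have hk : h x <= c + k%:~R by have := floor_le (c - h x); rewrite /k intrN; arith.
by have := below _ hk; have := floorD1 (c - h x); rewrite /k intrN; arith.
Qed.

End Necessity.

(** * From bounded chains to Lyapunov maps *)

Section Sup.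
Variable R : realType.
Implicit Types (A : set R).

Lemma sup_le_bound A a v : A a -> (forall w, A w -> w <= v) -> sup A <= v.
Proof. by move=> Aa Av; apply: ge_sup; [exists a|exact: Av]. Qed.

Lemma le_sup_bound A v a : (forall w, A w -> w <= v) -> A a -> a <= sup A.
Proof. by move=> Av; apply: ub_le_sup; exists v. Qed.

Lemma geometric_small (l e : R) : 0 < l < 1 -> 0 < e -> exists n : nat, l ^+ n < e.
Proof.
move=> /andP[l0 l1] e0; have : `|l| < 1 by rewrite gtr0_norm.
move=> /cvg_expr/cvgrPdist_lt/(_ e e0)[n _ /(_ n (leqnn n))] /=.
by rewrite sub0r normrN ger0_norm ?exprn_ge0 ?ltW //; exists n.
Qed.

Lemma geometric_le0 (l c v : R) : 0 < l < 1 -> (forall n, v <= c * l ^+ n) -> v <= 0.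
Proof.
move=> l01 vc; apply/ler_addgt0Pl => e e0; rewrite addr0.
have c1 : 0 < `|c| + 1 by rewrite ltr_wpDl.
have [|n ln] := geometric_small l01 (e := e / (`|c| + 1)); first by rewrite divr_gt0.
apply: le_trans (vc n) _; apply: le_trans (_ : (`|c| + 1) * l ^+ n <= e).
  apply: ler_wpM2r; first by rewrite exprn_ge0 // ltW; case/andP: l01.
  by apply: le_trans (ler_norm c) _; rewrite lerDl.
by rewrite mulrC -ler_pdivlMr // ltW.
Qed.

End Sup.

(** * Geometrically weighted mixtures of functions *)

Section Mixture.
Variables (R : realType) (X : metricType R) (f : nat -> X -> R) (F : X -> R).
Variables (B l : R).
Hypotheses (l01 : 0 < l < 1) (fB : forall i x, `|f i x - F x| <= B).
Implicit Types (x y : X).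

(* [mix n] is the convex combination with weights [(1 - l) * l ^ i] of
   [f i], [i < n], the remaining weight [l ^ n] being put on [F]. *)
Fixpoint mix (n : nat) x : R :=
  if n is m.+1 then mix m x + (1 - l) * l ^+ m * (f m x - F x) else F x.

Let l_gt0 : 0 < l. Proof. by case/andP: l01. Qed.
Let l_lt1 : l < 1. Proof. by case/andP: l01. Qed.
Let l_ge0 : 0 <= l. Proof. exact: ltW. Qed.
Let l_le1 : l <= 1. Proof. exact: ltW. Qed.
Let B_ge0 x : 0 <= B.
Proof. exact: le_trans (fB 0 x). Qed.

Lemma mix_cauchy n m x : `|mix n x - mix (m + n) x| <= B * (l ^+ n - l ^+ (m + n)).
Proof.
elim: m => [|m IH]; first by rewrite add0n !subrr normr0 mulr0.
rewrite addSn /=; set c := (1 - l) * l ^+ (m + n).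
have c0 : 0 <= c by rewrite mulr_ge0 ?subr_ge0 ?exprn_ge0 ?ltW.
have -> : B * (l ^+ n - l ^+ (m + n).+1) = B * (l ^+ n - l ^+ (m + n)) + c * B.
  by rewrite /c exprS; ring.
rewrite opprD addrA; apply: le_trans (ler_normB _ _) _; rewrite lerD //.
by rewrite normrM ger0_norm // ler_wpM2l.
Qed.

(** The limit of [mix n x], taken as the supremum of its lower bounds; [mixture_close] gives the
    rate. *)
Definition mixture x : R := sup [set v | exists n, v = mix n x - B * l ^+ n].

Lemma mix_close n m x : mix m x - B * l ^+ m <= mix n x + B * l ^+ n.
Proof.
have lp k : 0 <= B * l ^+ k by rewrite mulr_ge0 ?(B_ge0 x) ?exprn_ge0 ?ltW.
have := lp n; have := lp m.
case: (leqP n m) => [nm|/ltnW mn].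
  have := mix_cauchy n (m - n) x; rewrite subnK // ler_norml mulrBr; arith.
have := mix_cauchy m (n - m) x; rewrite subnK // ler_norml mulrBr; arith.
Qed.

Lemma mixture_close n x : `|mixture x - mix n x| <= B * l ^+ n.
Proof.
have up : mixture x <= mix n x + B * l ^+ n.
  by apply: (@sup_le_bound _ _ (mix 0 x - B * l ^+ 0)); [exists 0|move=> _ [m ->]; exact: mix_close].
have lo : mix n x - B * l ^+ n <= mixture x.
  apply: (@le_sup_bound _ _ (mix 0 x + B * l ^+ 0)); last by exists n.
  by move=> _ [m ->]; exact: mix_close.
by rewrite ler_norml; arith.
Qed.

Lemma mix_continuous n : continuous F -> (forall i, continuous (f i)) -> continuous (mix n).
Proof.
move=> Fc fc; elim: n => [//|n IH] x /=.
apply: cvgD; first exact: IH.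
by apply: cvgM; [exact: cvg_cst|apply: cvgB; [exact: fc|exact: Fc]].
Qed.

Lemma mixture_continuous : continuous F -> (forall i, continuous (f i)) -> continuous mixture.
Proof.
move=> Fc fc x; apply/cvgrPdist_lt => e e0.
have B1 : 0 < B + 1 by rewrite ltr_wpDl // (B_ge0 x).
have [|n ln] := geometric_small l01 (e := e / 3 / (B + 1)); first by rewrite !divr_gt0.
have Bn : B * l ^+ n < e / 3.
  apply: le_lt_trans (_ : (B + 1) * l ^+ n < _); last by rewrite mulrC -ltr_pdivlMr.
  by rewrite ler_wpM2r ?exprn_ge0 ?lerDl // ltW.
have [|d d0 dP] := real_continuity x (@mix_continuous n Fc fc) (e := e / 3).
  by rewrite divr_gt0.
apply/near_mdistP; exists d => // y /dP.
have := mixture_close n x; have := mixture_close n y.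
by rewrite !ler_norml !ltr_norml; arith.
Qed.

Lemma mixture_shift (t : X -> X) (c : R) x :
  F (t x) = F x + c -> (forall i, f i (t x) = f i x + c) -> mixture (t x) = mixture x + c.
Proof.
move=> Ft ft; have mt n : mix n (t x) = mix n x + c.
  by elim: n => [//|n /= ->]; rewrite Ft ft; ring.
apply/eqP; rewrite -subr_eq0 -normr_le0; apply: (geometric_le0 l01 (c := 2 * B)) => n.
have := mixture_close n x; have := mixture_close n (t x); rewrite mt !ler_norml; arith.
Qed.

(** Nothing is assumed on [F x - F y]: its weight [l ^+ n] vanishes in the limit. *)
Lemma mix_le n x y : (forall i, f i y <= f i x) ->
  l ^+ n * (F x - F y) <= mix n x - mix n y.
Proof.
move=> fyx; elim: n => [|n IH] /=; first by rewrite mul1r.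
have : 0 <= (1 - l) * l ^+ n * (f n x - f n y).
  by rewrite !mulr_ge0 ?subr_ge0 ?exprn_ge0.
rewrite exprS; move: IH; nra.
Qed.

Lemma mixture_le x y : (forall i, f i y <= f i x) -> mixture y <= mixture x.
Proof.
move=> fyx; rewrite -subr_le0; apply: (geometric_le0 l01 (c := 2 * B + `|F x - F y|)) => n.
have := mixture_close n x; have := mixture_close n y; have := mix_le n fyx.
have : - (l ^+ n * (F x - F y)) <= `|F x - F y| * l ^+ n.
  by rewrite -mulrN mulrC ler_wpM2r ?exprn_ge0 // -normrN ler_norm.
by rewrite !ler_norml; arith.
Qed.

Lemma mixture_lt i x y : (forall i, f i y <= f i x) -> f i y < f i x -> mixture y < mixture x.
Proof.
move=> fyx fi; pose c := (1 - l) * l ^+ i * (f i x - f i y).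
have c0 : 0 < c by rewrite !mulr_gt0 ?subr_gt0 ?exprn_gt0.
suff : c + mixture y - mixture x <= 0 by arith.
apply: (geometric_le0 l01 (c := 2 * B + `|F x - F y|)) => n.
(* Past index [i], so that the strict drop [c] of that term is already counted in [mix m]. *)
pose m := (n + i.+1)%N.
have mc : l ^+ m * (F x - F y) + c <= mix m x - mix m y.
  rewrite /m; elim: {m} n => [|n IH]; last first.
    have : 0 <= (1 - l) * l ^+ (n + i.+1) * (f (n + i.+1)%N x - f (n + i.+1)%N y).
      by rewrite !mulr_ge0 ?subr_ge0 ?exprn_ge0.
    rewrite addSn exprS /=; move: IH; nra.
  by have := mix_le i fyx; rewrite add0n exprS /= /c; nra.
have lmn : l ^+ m <= l ^+ n by rewrite ler_wiXn2l ?leq_addr // ltW.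
have : - (l ^+ m * (F x - F y)) <= `|F x - F y| * l ^+ m.
  by rewrite -mulrN mulrC ler_wpM2r ?exprn_ge0 // -normrN ler_norm.
have : (2 * B + `|F x - F y|) * l ^+ m <= (2 * B + `|F x - F y|) * l ^+ n.
  by rewrite ler_wpM2l // addr_ge0 // mulr_ge0 // (B_ge0 x).
have := mixture_close m x; have := mixture_close m y.
by rewrite !ler_norml; arith.
Qed.

(** Let [j] be the first index where the values differ, by an integer [k]. The later terms have
    total weight [l ^+ j.+1] and stay within [B] of [F], so that equality of the mixtures gives
    [|k| <= 4 * B * l < 1]. *)
Lemma mixture_separates x y : 4 * B * l < 1 ->
  (forall i, exists k : int, f i x - f i y = k%:~R) ->
  mixture x = mixture y -> forall i, f i x = f i y.
Proof.
move=> Bl fint mxy i; apply: contrapT => fi.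
have exP : exists i, f i x != f i y by exists i; apply/eqP.
have [j fj jmin] := ex_minnP exP.
have mj : mix j x - mix j y = l ^+ j * (F x - F y).
  have : (j <= j)%N by [].
  elim: {1 3 4 5}j => [_|m IH mj] /=; first by rewrite mul1r.
  have fm : f m x = f m y.
    by apply/eqP/negPn/negP => /jmin; rewrite leqNgt mj.
  by rewrite exprS fm; have := IH (ltnW mj); nra.
have lj : 0 < l ^+ j by rewrite exprn_gt0.
have [k kE] := fint j.
have : `|l ^+ j * (l * (F x - F y) + (1 - l) * k%:~R)| <= l ^+ j * (2 * (B * l)).
  have := mixture_close j.+1 x; have := mixture_close j.+1 y; rewrite mxy /= exprS -kE.
  rewrite !ler_norml; move: mj; nra.
rewrite normrM gtr0_norm // ler_pM2l // => H.
have : `|k%:~R : R| < 1.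
  have : `|l * (F x - F y - (f j x - f j y))| <= l * (2 * B).
    rewrite normrM gtr0_norm // ler_pM2l //.
    by have := fB j x; have := fB j y; rewrite !ler_norml; arith.
  by move: Bl H; rewrite -kE !ler_norml ltr_norml; arith.
rewrite -[k%:~R]subr0 => /(@int_close R k 0) k0.
by move: kE fj; rewrite k0 => /eqP; rewrite subr_eq0 => ->.
Qed.

End Mixture.

(** * Truncated sup-convolution along the flow *)

Section SupConvolution.
Variables (R : realType) (X : metricType R) (psi : R -> X -> X).
Variables (deck : int -> X -> X).
Hypothesis sys : Z_cover_flow psi deck.
Let psi_flow := zflow sys.
Implicit Types (e d s t v : R) (x y z : X) (k l : int).

(** The inequality for [- k] at [deck k x] is the converse one. *)
Lemma Z_equivariant_ge (f : X -> R) :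
  (forall k x, f x + k%:~R <= f (deck k x)) -> Z_equivariant deck f.
Proof.
move=> fk k x; apply/eqP; rewrite eq_le fk andbT.
by have := fk (- k) (deck k x); rewrite (deckK sys) intrN; arith.
Qed.

Variables (L : X -> R) (S r B : R).
Hypotheses (S_ge0 : 0 <= S) (r_gt0 : 0 < r)
  (L_osc : forall y z, mdist y z < 2 * r -> L y <= L z + B)
  (L_orbit : forall x, exists b, forall s, 0 <= s <= S -> L (psi s x) <= b).

(* With the slope [B / r], points [y] at distance close to [r] never contribute more than
   [psi s x] itself: this is what makes the truncation at distance [r] continuous. *)
Definition supconv x : R := sup [set v | exists s y, [/\ 0 <= s <= S,
  mdist (psi s x) y < r & v = L y - B / r * mdist (psi s x) y]].

Let B_ge0 (x : X) : 0 <= B.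
Proof. by have := @L_osc x x; rewrite mdistxx mulr_gt0 // lerDl; apply. Qed.

Lemma supconv_bounded x : exists b, forall v, (exists s y, [/\ 0 <= s <= S,
  mdist (psi s x) y < r & v = L y - B / r * mdist (psi s x) y]) -> v <= b.
Proof.
have [b bP] := L_orbit x; exists (b + B) => _ [s [y [sS xy ->]]].
have Br : 0 <= B / r * mdist (psi s x) y.
  by rewrite !mulr_ge0 ?mdist_ge0 ?invr_ge0 ?(B_ge0 x) ?ltW.
have := bP s sS; have := @L_osc y (psi s x).
have : mdist y (psi s x) < 2 * r by rewrite metric_sym; have := r_gt0; arith.
by move=> yx /(_ yx); arith.
Qed.

Lemma supconv_ge s x y : 0 <= s <= S -> mdist (psi s x) y < r ->
  L y - B / r * mdist (psi s x) y <= supconv x.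
Proof.
move=> sS xy; have [b bP] := supconv_bounded x.
by apply: (le_sup_bound bP); exists s, y.
Qed.

Lemma supconv_ge_orbit s x : 0 <= s <= S -> L (psi s x) <= supconv x.
Proof.
move=> sS; have := @supconv_ge s x (psi s x) sS; rewrite mdistxx mulr0 subr0.
exact.
Qed.

Lemma supconv_le x v : (forall s y, 0 <= s <= S -> mdist (psi s x) y < r ->
  L y - B / r * mdist (psi s x) y <= v) -> supconv x <= v.
Proof.
move=> xv; apply: (@sup_le_bound _ _ (L x)) => [|_ [s [y [sS xy ->]]]]; last exact: xv.
exists 0, x; rewrite (flow0 psi_flow) mdistxx mulr0 subr0; split=> //.
by rewrite lexx S_ge0.
Qed.

Lemma supconv_le_sup x v : (forall s y, 0 <= s <= S -> mdist (psi s x) y < r -> L y <= v) ->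
  supconv x <= v.
Proof.
move=> xv; apply: supconv_le => s y sS xy; apply: le_trans (xv s y sS xy).
by rewrite gerBl !mulr_ge0 ?mdist_ge0 ?invr_ge0 ?(B_ge0 x) ?ltW.
Qed.

(** A point [y] no longer within [r] of [psi s x'] has a penalty of at least [B - B / r * e] at [x];
    by [L_osc], [psi s x'] itself then does as well up to [B / r * e]. *)
Lemma supconv_near x x' e : e <= r ->
  (forall s, 0 <= s <= S -> mdist (psi s x) (psi s x') < e) ->
  supconv x <= supconv x' + B / r * e.
Proof.
move=> er xx; apply: supconv_le => s y sS xy; have sx := xx s sS.
have Br : 0 <= B / r by rewrite divr_ge0 ?(B_ge0 x) // ltW.
have tri := metric_triangle (psi s x') (psi s x) y.
have tri' := metric_triangle y (psi s x) (psi s x').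
rewrite [mdist (psi s x') (psi s x)]metric_sym in tri.
rewrite [mdist y (psi s x)]metric_sym in tri'.
have [x'y|yx'] := ltP (mdist (psi s x') y) r.
  have := supconv_ge sS x'y.
  have : B / r * mdist (psi s x') y <= B / r * (e + mdist (psi s x) y).
    by rewrite ler_wpM2l //; arith.
  by rewrite mulrDr; arith.
have := supconv_ge_orbit x' sS; have := @L_osc y (psi s x').
have yy : mdist y (psi s x') < 2 * r by arith.
have : B / r * (r - e) <= B / r * mdist (psi s x) y by rewrite ler_wpM2l //; arith.
rewrite mulrBr divfK ?gt_eqF // => ? /(_ yy); arith.
Qed.

Lemma supconv_continuous : continuous supconv.
Proof.
move=> x; apply/cvgrPdist_lt => e e0; have B0 := B_ge0 x.
have Br : 0 <= B / r by rewrite divr_ge0 // ltW.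
have Br1 : 0 < B / r + 1 by rewrite ltr_wpDl.
pose a := Num.min r (e / (B / r + 1)).
have a0 : 0 < a by rewrite lt_min r_gt0 divr_gt0.
have ae : B / r * a < e.
  apply: lt_le_trans (_ : (B / r + 1) * a <= _); first by rewrite ltr_pM2r // ltrDl.
  by rewrite mulrC -ler_pdivlMr // ge_min lexx orbT.
have ar : a <= r by rewrite ge_min lexx.
have [d d0 dP] := flow_uniform sys S a0.
apply/near_mdistP; exists d => // y xy; rewrite ltr_norml.
have sx s : 0 <= s <= S -> mdist (psi s x) (psi s y) < a.
  by move=> sS; apply: dP => //; rewrite ger0_norm; case/andP: sS.
have := supconv_near ar sx; have := @supconv_near y x a ar.
have sy s : 0 <= s <= S -> mdist (psi s y) (psi s x) < a by rewrite metric_sym; exact: sx.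
by move=> /(_ sy); arith.
Qed.

Lemma supconv_equivariant : Z_equivariant deck L -> Z_equivariant deck supconv.
Proof.
move=> Leq; apply: Z_equivariant_ge => k x.
rewrite -lerBrDr; apply: supconv_le => s y sS xy; rewrite lerBrDr.
have := @supconv_ge s (deck k x) (deck k y) sS.
by rewrite (deck_flow sys) (deck_iso sys) Leq => /(_ xy); arith.
Qed.

End SupConvolution.

Lemma seq_uniform_bound (R : realType) (Y : eqType) (s : seq Y) (Q : Y -> R -> Prop) :
  (forall y, exists b, forall v, Q y v -> v <= b) ->
  exists b, forall y, y \in s -> forall v, Q y v -> v <= b.
Proof.
move=> Qb; elim: s => [|y s [b bP]]; first by exists 0.
have [c cP] := Qb y; exists (Num.max b c) => z; rewrite inE.
by move=> /orP[/eqP -> v /cP vc|/bP zb v /zb vb]; rewrite le_max ?vc ?vb ?orbT.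
Qed.

(** * Existence of continuous equivariant functions *)

Section EquivariantFunction.
Variables (R : realType) (X : metricType R) (psi : R -> X -> X).
Variables (deck : int -> X -> X).
Hypothesis sys : Z_cover_flow psi deck.
Implicit Types (e d s t v : R) (x y z : X) (k l : int).

(** The largest index [k] of a translate [deck k c] of a net point near [y] is equivariant in [y]
    and has bounded oscillation. Its sup-convolution, without flow ([S = 0]), is continuous. *)
Lemma equivariant_function : exists2 F : X -> R, continuous F & Z_equivariant deck F.
Proof.
have [r r0 rP] := deck_discrete sys.
(* Below, translates of net points near [y] and [z] are less than [a + 4 * a + a] apart, hence less
   than [r / 2]. *)
pose a := r / 16; have a0 : 0 < a by rewrite divr_gt0.
have [s sP] := deck_net sys a0.
(* By [deck_discrete], two translates of [c'] within [r / 2] of [c] have the same index, so only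
   finitely many [k] occur. *)
have [B BP] : exists B, forall c c', c \in s -> c' \in s ->
    forall k, mdist c (deck k c') < r / 2 -> `|k%:~R : R| <= B.
  have [|B BP] := @seq_uniform_bound R X s (fun c v => exists c' k,
    [/\ c' \in s, mdist c (deck k c') < r / 2 & v = `|k%:~R|]).
  - move=> c; have [|b bP] := @seq_uniform_bound R X s (fun c' v => exists k,
      mdist c (deck k c') < r / 2 /\ v = `|k%:~R|).
    + move=> c'; have [[k ck]|nk] := pselect (exists k, mdist c (deck k c') < r / 2).
        exists `|k%:~R| => _ [l [cl ->]]; suff -> : l = k by [].
        apply/eqP; rewrite -subr_eq0; apply/eqP; apply: (rP _ (deck k c')).
        rewrite -(deckD sys) subrK (splitr r) metric_sym.
        by apply: le_lt_trans (metric_triangle _ c _) _; rewrite ltrD // metric_sym.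
      by exists 0 => v [k [ck _]]; case: nk; exists k.
    + exists b => _ [c' [k [c's ck ->]]]; by apply: (bP c' c's); exists k.
  by exists B => c c' cs c's k ck; apply: (BP c) => //; exists c', k.
pose E y := [set v : R | exists k c, [/\ c \in s, mdist (deck k c) y < a & v = k%:~R]].
have E0 y : exists v, E y v.
  have [k [c [cs cy]]] := sP y; exists (- k)%:~R, (- k), c; split => //.
  by rewrite -(deck_iso sys k) (deckNK sys).
have Ed y z v w : mdist y z < 4 * a -> E y v -> E z w -> v <= w + B.
  move=> yz [k [c [cs cy ->]]] [l [c' [c's cz ->]]].
  suff : `|(l - k)%:~R : R| <= B by rewrite intrB ler_norml; arith.
  apply: (BP c c') => //; rewrite -(deck_iso sys k) -(deckD sys) addrC subrK.
  apply: le_lt_trans (metric_triangle _ y _) _.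
  apply: le_lt_trans (_ : _ <= mdist (deck k c) y + (mdist y z + mdist z (deck l c'))) _.
    by rewrite lerD2l metric_triangle.
  by rewrite [mdist z _]metric_sym; move: yz cy cz; rewrite /a; arith.
pose L y := sup (E y).
have Lub y v : E y v -> v <= L y.
  have [w wE] := E0 y; apply: (@le_sup_bound _ _ (w + B)) => u uE.
  by apply: (Ed y y) => //; rewrite mdistxx mulr_gt0.
have Leq : Z_equivariant deck L.
  apply: (Z_equivariant_ge sys) => k x; have [w wE] := E0 x.
  rewrite -lerBrDr; apply: (sup_le_bound wE) => _ [l [c [cs lx ->]]].
  rewrite lerBrDr -intrD; apply: Lub; exists (k + l), c; split => //.
    by rewrite (deckD sys) (deck_iso sys).
  by rewrite addrC.
have Losc y z : mdist y z < 2 * (2 * a) -> L y <= L z + B.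
  move=> yz; have [w wE] := E0 y; apply: (sup_le_bound wE) => v vE.
  have [u uE] := E0 z; apply: le_trans (Ed _ _ _ _ _ vE uE) _; first by arith.
  by rewrite lerD2r Lub.
have Lorb x : exists b, forall t, 0 <= t <= 0 -> L (psi t x) <= b.
  by exists (L x) => t t0; have -> : t = 0; [arith|rewrite (flow0 (zflow sys))].
have a2 : 0 < 2 * a by rewrite mulr_gt0.
exists (supconv psi L 0 (2 * a) B).
  exact: (supconv_continuous sys (lexx 0) a2 Losc Lorb).
exact: (supconv_equivariant sys (lexx 0) a2 Losc Lorb Leq).
Qed.

End EquivariantFunction.

(** * Equivariant functions with bounded growth along chains *)

Section Sufficiency.
Variables (R : realType) (X : metricType R) (psi : R -> X -> X).
Variables (deck : int -> X -> X) (T : R).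
Hypotheses (sys : Z_cover_flow psi deck) (T_gt0 : 0 < T).
Let psi_flow := zflow sys.
Ltac arithT := have := T_gt0; arith.
Implicit Types (e d s t u v : R) (x y z w a : X) (k l : int).
Local Notation reach := (reach psi T).
Local Notation chains := (chains psi T).

Lemma dense_orbits (x0 : X) : exists A : nat -> X,
  forall x e, 0 < e -> exists i k, mdist (deck k (A i)) x < e.
Proof.
have /choice[s sP] : forall m : nat, exists s : seq X, forall y, exists k c,
    c \in s /\ mdist c (deck k y) < m.+1%:R^-1.
  by move=> m; apply: (deck_net sys); rewrite invr_gt0.
(* The index encodes the [j]-th point of a net of mesh [1 / m.+1]; [x0] and [(0, 0)] are default
   values. *)
exists (fun i => let: (m, j) := odflt (0, 0)%N (unpickle i) in nth x0 (s m) j).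
move=> x e e0; pose m := Num.truncn e^-1.
have me : m.+1%:R^-1 < e.
  by rewrite invf_plt ?posrE // truncnS_gt.
have [k [c [cs cx]]] := sP m x.
exists (pickle (m, index c (s m))), (- k); rewrite pickleK /= nth_index //.
by apply: lt_trans me; rewrite -(deck_iso sys k) (deckNK sys).
Qed.

Variables (F : X -> R) (C eps0 : R).
Hypotheses (F_cont : continuous F) (F_eq : Z_equivariant deck F).
Hypotheses (C_ge0 : 0 <= C) (eps0_gt0 : 0 < eps0).
Hypotheses (F_reach : forall x y, reach eps0 x y -> F y <= F x + C)
  (F_osc : forall y z, mdist y z < 2 * eps0 -> F y <= F z + 1).

(** Repeating the chain would raise [F] by multiples of [k], beyond [C]. *)
Lemma no_ascent x k : reach eps0 x (deck k x) -> k <= 0.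
Proof.
move=> xk; rewrite leNgt; apply/negP => k0.
have xn (n : nat) : reach eps0 x (deck (k * n.+1%:Z) x).
  elim: n => [|n IH]; first by rewrite mulr1.
  apply: (reach_trans xk); rewrite -(addn1 n.+1) PoszD mulrDr mulr1 addrC (deckD sys).
  exact: reach_deck.
have := F_reach (xn (Num.truncn C)); rewrite F_eq lerD2l leNgt => /negP; apply.
apply: lt_le_trans (truncnS_gt C) _; rewrite intrM -[X in X <= _]mul1r.
by rewrite ler_wpM2r // -[1]/(1%:~R) ler_int.
Qed.

(** At the fixed times [- T] and [5 * T] the change of [F] is continuous and invariant, hence
    bounded. The point [psi s x] is reached from the first of these points and reaches the second,
    which bounds [F] on both sides. *)
Lemma F_orbit : exists2 b, 0 <= b &
  forall x s, 0 <= s <= 4 * T -> `|F (psi s x) - F x| <= b.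
Proof.
have Fb t : exists2 b, 0 <= b & forall x, `|F (psi t x) - F x| <= b.
  apply: (invariant_bounded (deck_uniform sys)).
    move=> x; apply: cvgB; last exact: F_cont.
    apply: (@cvg_comp _ _ _ (psi t) F _ (nbhs (psi t x))); last exact: F_cont.
    apply/metricType_numDomainType.cvgrPdist_lt => e e0.
    have [d d0 dP] := flow_uniform sys `|t| e0; apply/near_mdistP.
    by exists d => // y; exact: dP.
  by move=> k x; rewrite (deck_flow sys) !F_eq; arith.
have [b b0 bP] := Fb (- T); have [c c0 cP] := Fb (5 * T).
exists (b + c + C) => [|x s sT]; first by rewrite !addr_ge0.
have R1 : F (psi s x) <= F (psi (- T) x) + C.
  have -> : psi s x = psi (s + T) (psi (- T) x) by rewrite -(flowD psi_flow) addrK.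
  apply: F_reach.
  by apply: (reach_flow0 sys T_gt0 _ eps0_gt0); arithT.
have R2 : F (psi (5 * T) x) <= F (psi s x) + C.
  have -> : psi (5 * T) x = psi (5 * T - s) (psi s x) by rewrite -(flowD psi_flow) subrK.
  apply: F_reach.
  by apply: (reach_flow0 sys T_gt0 _ eps0_gt0); arithT.
by have := bP x; have := cP x; rewrite !ler_norml; arith.
Qed.

(** * Integer levels reached by chains, and their regularization *)

Section ReachMax.
Variables (b D eps : R) (g : X -> int).
Hypotheses (b_ge0 : 0 <= b) (D_ge0 : 0 <= D)
  (F_b : forall x s, 0 <= s <= 4 * T -> `|F (psi s x) - F x| <= b).
Hypotheses (eps_gt0 : 0 < eps) (eps_le : eps <= eps0).
Hypotheses (g_eq : forall k x, g (deck k x) = g x + k)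
  (g_F : forall x, `|(g x)%:~R - F x| <= D).

Definition reach_max x : R := sup [set v | exists2 y, reach eps x y & v = (g y)%:~R].

(** The gap between the bounds [F + C + D] and [F - b - D] of [reach_max], plus the oscillation 1 of
    [F]. *)
Let B : R := C + 2 * D + b + 1.

Lemma reach_max_ub x y : reach eps x y -> (g y)%:~R <= F x + C + D.
Proof.
move=> /(reach_le eps_le)/F_reach; have := g_F y; rewrite ler_norml; arith.
Qed.

Lemma reach_max_ge x y : reach eps x y -> (g y)%:~R <= reach_max x.
Proof.
move=> xy; apply: (@le_sup_bound _ _ (F x + C + D)); last by exists y.
by move=> _ [z xz ->]; exact: reach_max_ub.
Qed.

Lemma reach_T x : reach eps x (psi T x).
Proof. exact: (reach_flow0 sys T_gt0 _ eps_gt0). Qed.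

Lemma reach_max_le x v : (forall y, reach eps x y -> (g y)%:~R <= v) -> reach_max x <= v.
Proof.
move=> xv; apply: (@sup_le_bound _ _ (g (psi T x))%:~R).
  by exists (psi T x) => //; exact: reach_T.
by move=> _ [y xy ->]; exact: xv.
Qed.

(** An integer value above the supremum minus 1 is the maximum. *)
Lemma reach_max_attained x : exists2 y, reach eps x y & reach_max x = (g y)%:~R.
Proof.
have [[y xy yx]|ny] := pselect (exists2 y, reach eps x y & reach_max x - 1 < (g y)%:~R).
  exists y => //; apply/eqP; rewrite eq_le reach_max_ge // andbT.
  apply: reach_max_le => z xz; rewrite ler_int -(@int_ltD1 R).
  by have := reach_max_ge xz; arith.
have : reach_max x <= reach_max x - 1; last by arith.
by apply: reach_max_le => y xy; rewrite leNgt; apply/negP => yx; apply: ny; exists y.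
Qed.

Lemma reach_max_upper x : reach_max x <= F x + C + D.
Proof. by apply: reach_max_le => y; exact: reach_max_ub. Qed.

Lemma reach_max_lower x : F x - b - D <= reach_max x.
Proof.
apply: le_trans (reach_max_ge (reach_T x)).
have TT : 0 <= T <= 4 * T by arithT.
by have := g_F (psi T x); have := F_b x TT; rewrite !ler_norml; arith.
Qed.

Lemma reach_max_mono x y : reach eps x y -> reach_max y <= reach_max x.
Proof.
move=> xy; apply: reach_max_le => z yz; apply: reach_max_ge; exact: reach_trans yz.
Qed.

Lemma reach_max_equivariant : Z_equivariant deck reach_max.
Proof.
apply: (Z_equivariant_ge sys) => k x; rewrite -lerBrDr; apply: reach_max_le => y xy.
rewrite lerBrDr -intrD -g_eq; apply: reach_max_ge; exact: reach_deck.
Qed.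

Lemma reach_max_osc y z : mdist y z < 2 * eps -> reach_max y <= reach_max z + B.
Proof.
move=> yz; have := reach_max_upper y; have := reach_max_lower z.
have : mdist y z < 2 * eps0 by have := eps_le; arith.
by move=> /F_osc; rewrite /B; arith.
Qed.

Lemma reach_max_orbit x : exists c, forall s, 0 <= s <= T -> reach_max (psi s x) <= c.
Proof.
exists (F x + b + C + D) => s sT; have s4 : 0 <= s <= 4 * T by arithT.
by have := reach_max_upper (psi s x); have := F_b x s4; rewrite ler_norml; arith.
Qed.

Definition smooth_max : X -> R := supconv psi reach_max T eps B.

Let T_ge0 : 0 <= T. Proof. exact: ltW. Qed.

Lemma smooth_max_continuous : continuous smooth_max.
Proof. exact: (supconv_continuous sys T_ge0 eps_gt0 reach_max_osc reach_max_orbit). Qed.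

Lemma smooth_max_equivariant : Z_equivariant deck smooth_max.
Proof.
exact: (supconv_equivariant sys T_ge0 eps_gt0 reach_max_osc reach_max_orbit
  reach_max_equivariant).
Qed.

Lemma smooth_max_ge s x : 0 <= s <= T -> reach_max (psi s x) <= smooth_max x.
Proof. exact: (supconv_ge_orbit eps_gt0 reach_max_osc reach_max_orbit). Qed.

Lemma smooth_max_ge0 x : reach_max x <= smooth_max x.
Proof. by have := @smooth_max_ge 0 x; rewrite (flow0 psi_flow) lexx T_ge0; apply. Qed.

Lemma smooth_max_le x v : (forall s y, 0 <= s <= T -> mdist (psi s x) y < eps ->
  reach_max y <= v) -> smooth_max x <= v.
Proof. exact: (supconv_le_sup sys T_ge0 eps_gt0 reach_max_osc). Qed.

(** After time [T], every point entering the supremum is reached from [x]. *)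
Lemma smooth_max_flow x t : T <= t -> smooth_max (psi t x) <= reach_max x.
Proof.
move=> Tt; apply: smooth_max_le => s y sT xy; apply: reach_max_mono.
apply: (@reach_flow _ _ _ _ psi_flow T_gt0 _ (s + t)) => //; first arithT.
by rewrite (flowD psi_flow).
Qed.

(** A competitor of [psi t x] at time [s] competes for [x] at time [s + t] if [s + t <= T];
    otherwise it is reached from [x]. *)
Lemma smooth_max_nonincreasing x t : 0 <= t -> smooth_max (psi t x) <= smooth_max x.
Proof.
apply: (nonincreasing_flow sys T_gt0) => {}x {}t tT.
apply: (supconv_le sys T_ge0 eps_gt0) => s y sT; rewrite -(flowD psi_flow) => xy.
have [stT|Tst] := leP (s + t) T.
  by apply: (supconv_ge eps_gt0 reach_max_osc reach_max_orbit); first arith.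
apply: le_trans (smooth_max_ge0 x); apply: le_trans (reach_max_mono _).
  have : reach_max y - 0 <= reach_max y by rewrite subr0.
  apply: le_trans; rewrite lerB // !mulr_ge0 ?mdist_ge0 ?invr_ge0 ?ltW //.
  by rewrite /B; have := C_ge0; have := D_ge0; have := b_ge0; arith.
by apply: (reach_flow psi_flow T_gt0 eps_gt0 _ xy); exact: ltW.
Qed.

Lemma smooth_max_recurrent x : chains x x -> smooth_max x = reach_max x.
Proof.
move=> xx; apply/eqP; rewrite eq_le smooth_max_ge0 andbT.
apply: smooth_max_le => s y sT xy; apply: reach_max_mono.
have xs : chains x (psi s x) by apply: (chains_extend sys T_gt0) => //; case/andP: sT.
(* A chain from [x] to [psi s x] with jumps below [e / 2] is redirected to [y], at a cost less than
   [eps - e / 2]. *)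
pose e := eps - mdist (psi s x) y.
have -> : eps = e / 2 + (eps - e / 2) by arith.
apply: (@reach_end_near _ _ _ _ _ _ _ (psi s x)); first by rewrite /e; move: xy; arith.
by apply: xs; rewrite divr_gt0 // subr_gt0.
Qed.

Lemma smooth_max_recurrent_flow x q : chains x x -> 0 <= q ->
  smooth_max (psi q x) = reach_max x.
Proof.
move=> xx q0; have qx := chains_skip_all sys T_gt0 q0 xx.
have xq := chains_extend sys T_gt0 q0 xx.
rewrite smooth_max_recurrent; last exact: chains_trans qx xq.
by apply/eqP; rewrite eq_le !reach_max_mono //; [exact: qx|exact: xq].
Qed.

Lemma smooth_max_bound x q : 0 <= q <= 3 * T ->
  `|smooth_max (psi q x) - F x| <= 2 * b + C + D + 1.
Proof.
move=> qT; have q4 : 0 <= q <= 4 * T by arithT.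
have := F_b x q4; have := smooth_max_ge0 (psi q x); have := reach_max_lower (psi q x).
suff : smooth_max (psi q x) <= F (psi q x) + b + C + D + 1.
  by rewrite !ler_norml; have := b_ge0; have := C_ge0; arith.
apply: smooth_max_le => s y sT xy; have s4 : 0 <= s <= 4 * T by arithT.
have yx : mdist y (psi s (psi q x)) < 2 * eps0.
  by rewrite metric_sym; have := eps_le; have := eps_gt0; arith.
have := F_osc yx; have := reach_max_upper y; have := F_b (psi q x) s4.
by rewrite ler_norml; arith.
Qed.

End ReachMax.

(** * Separating levels and the Lyapunov map *)

Section Assembly.
Variables (b : R) (D : nat) (A : nat -> X).
Hypotheses (b_ge0 : 0 <= b)
  (F_b : forall x s, 0 <= s <= 4 * T -> `|F (psi s x) - F x| <= b)
  (D_big : 2 * C + 6 < D%:R)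
  (A_dense : forall x e, 0 < e -> exists i k, mdist (deck k (A i)) x < e).

(** The raised orbit is that of [a] under the deck group, not under the flow; this keeps the
    function equivariant. *)
Definition marked a x : int :=
  Num.floor (F x) + (if `[< exists k, x = deck k a >] then D%:Z else 0).

Lemma marked_equivariant a k x : marked a (deck k x) = marked a x + k.
Proof.
rewrite /marked F_eq floorDrz ?intr_int // intrKfloor addrAC.
suff -> : `[< exists l, deck k x = deck l a >] = `[< exists l, x = deck l a >] by [].
apply/asbool_equiv_eq; split=> -[l].
  by move=> E; exists (- k + l); rewrite (deckD sys) -E (deckK sys).
by move=> ->; exists (k + l); rewrite (deckD sys).
Qed.

Lemma marked_close a x : `|(marked a x)%:~R - F x| <= D%:R + 1.
Proof.
have := floor_le (F x); have := floorD1 (F x); have : 0 <= D%:R :> R by [].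
by rewrite /marked intrD ler_norml; case: ifP => _; rewrite ?mulr0z; arith.
Qed.

Lemma marked_orbit a k : (marked a (deck k a))%:~R = (Num.floor (F (deck k a)))%:~R + D%:R :> R.
Proof. by rewrite /marked asboolT ?intrD //; exists k. Qed.

Definition radius (e : nat) : R := eps0 / e.+1%:R.

Lemma radius_gt0 (e : nat) : 0 < radius e.
Proof. by rewrite divr_gt0. Qed.

Lemma radius_le (e : nat) : radius e <= eps0.
Proof. by rewrite ler_pdivrMr // ler_peMr // ?ler1n // ltW. Qed.

Lemma radius_small v : 0 < v -> exists e : nat, radius e < v.
Proof.
move=> v0; exists (Num.truncn (eps0 / v)).
by rewrite ltr_pdivrMr // mulrC -ltr_pdivrMr // truncnS_gt.
Qed.

Definition level a (e : nat) : X -> R := reach_max (radius e) (marked a).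

Lemma level_ge a k (e : nat) y : reach (radius e) y (deck k a) ->
  (Num.floor (F (deck k a)))%:~R + D%:R <= level a e y.
Proof.
move=> ya; rewrite -marked_orbit.
exact: (reach_max_ge (radius_le e) (marked_close a) ya).
Qed.

(** The maximum is attained at some [z]. If [z] is a translate of [a], the last jump is redirected
    to the same translate of [y]; if not, [F] alone has to make up for the height [D]. *)
Lemma level_reach a l (e : nat) x y : mdist (deck l a) y < radius e ->
  (Num.floor (F (deck l a)))%:~R + D%:R <= level a e x ->
  (exists2 k, 0 <= k & reach (2 * radius e) x (deck k y)) \/
  F y + D%:R <= F x + C + 3.
Proof.
move=> ay; rewrite /level.
have [z xz ->] := reach_max_attained (radius_gt0 e) (radius_le e) (marked_close a) x.
have fz := floor_le (F z); have fa := floorD1 (F (deck l a)).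
rewrite /marked intrD; case: asboolP => [[k zk]|_] az.
  left; exists (k - l).
    (* A translate of [a] below [deck l a] has a smaller floor, while the height [D] occurs on both
       sides. *)
    rewrite leNgt; apply/negP => kl; have : (k - l)%:~R <= -1 :> R.
      by rewrite -[-1]/((-1)%:~R) ler_int; lia.
    have : F z = F (deck l a) + (k - l)%:~R by rewrite zk -F_eq -(deckD sys) subrK.
    by move: az; arith.
  rewrite mulr_natl mulr2n; apply: (@reach_end_near _ _ _ _ _ _ _ z) => //.
  have -> : z = deck (k - l) (deck l a) by rewrite zk -(deckD sys) subrK.
  by rewrite (deck_iso sys).
right; have := F_reach (reach_le (radius_le e) xz).
have : mdist y (deck l a) < 2 * eps0.
  by rewrite metric_sym; have := radius_le e; have := eps0_gt0; arith.
by move=> /F_osc; move: az; rewrite addr0; arith.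
Qed.

(** A marked orbit near [y] has the same level from [x] and [y], so [x] reaches [deck k y] with
    [k >= 0] or [F] rises by about [D]; likewise with [x] and [y] exchanged. As [D > 2 * C + 6],
    both rises are excluded, and [no_ascent] on the closed-up chain forces [k = 0]. *)
Lemma same_levels_chains x y : chains x x -> chains y y ->
  (forall i (e : nat), level (A i) e x = level (A i) e y) -> chains x y.
Proof.
move=> xx yy lxy eps e0; have [|e ev] := @radius_small (Num.min eps eps0 / 2).
  by rewrite divr_gt0 // lt_min e0.
have half z w : chains w w -> (forall i (e : nat), level (A i) e z = level (A i) e w) ->
    (exists2 k, 0 <= k & reach (2 * radius e) z (deck k w)) \/
    F w + D%:R <= F z + C + 3.
  move=> ww lzw; have re := radius_gt0 e.
  have [|i [l al]] := @A_dense w (radius e / 2); first by rewrite divr_gt0.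
  apply: (@level_reach (A i) l); first by arith.
  rewrite lzw; apply: level_ge; rewrite (splitr (radius e)).
  apply: (@reach_end_near _ _ _ _ _ _ _ w); first by rewrite metric_sym.
  by apply: ww; rewrite divr_gt0.
have [r_eps r_eps0] : 2 * radius e <= eps /\ 2 * radius e <= eps0.
  have : Num.min eps eps0 <= eps /\ Num.min eps eps0 <= eps0 by rewrite !ge_min !lexx orbT.
  by move: ev; arith.
have F2 z w k : 0 <= k -> reach (2 * radius e) z (deck k w) -> F w <= F z + C.
  move=> k0 /(reach_le r_eps0)/F_reach; rewrite F_eq.
  have : 0 <= k%:~R :> R by rewrite ler0z.
  by arith.
have DC := D_big; have C0 := C_ge0.
case: (half x y yy lxy) => [[k k0 xy]|Fxy]; last first.
  case: (half y x xx (fun i (m : nat) => esym (lxy i m))) => [[l l0 yx]|Fyx]; last by arith.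
  by have := F2 _ _ _ l0 yx; arith.
case: (half y x xx (fun i (m : nat) => esym (lxy i m))) => [[l l0 yx]|Fyx]; last first.
  by have := F2 _ _ _ k0 xy; arith.
have : k + l <= 0.
  apply: (@no_ascent x); apply: (reach_le r_eps0); apply: (reach_trans xy).
  by rewrite (deckD sys); exact: reach_deck.
have [k00|kN0] := eqVneq k 0; last by move/eqP: kN0; lia.
by rewrite k00 (deck0 sys) in xy => _; exact: reach_le r_eps xy.
Qed.

Definition smooth_level a (e : nat) : X -> R := smooth_max b (D%:R + 1) (radius e) (marked a).

Let D1_ge0 : 0 <= D%:R + 1 :> R. Proof. exact: addr_ge0. Qed.

(** An orbit marked near [psi T x] is reached from [x]. From [psi (2 * T) x] its level is no longer
    attained, or [psi T x] would return near itself. The last time [T] compensates for the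
    regularization. *)
Lemma smooth_level_drops x : ~ chains x x ->
  exists i (e : nat), smooth_level (A i) e (psi (3 * T) x) < smooth_level (A i) e x.
Proof.
move=> nxx; pose x' := psi T x.
have [eps [e0 nx']] : exists eps, 0 < eps /\ ~ reach eps x' x'.
  apply: contrapT => H; apply: nxx.
  have <- : psi (- T) x' = x by rewrite -(flowD psi_flow) addNr (flow0 psi_flow).
  apply: (chains_shift sys) => eps e0; apply: contrapT => nx'.
  by apply: H; exists eps.
have [|e ev] := @radius_small (Num.min eps eps0 / 2).
  by rewrite divr_gt0 // lt_min e0.
have [r_eps r_eps0] : 2 * radius e <= eps /\ 2 * radius e <= eps0.
  have : Num.min eps eps0 <= eps /\ Num.min eps eps0 <= eps0 by rewrite !ge_min !lexx orbT.
  by move: ev; arith.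
have re := radius_gt0 e.
have [i [l al]] := A_dense x' re; exists i, e.
have lx : (Num.floor (F (deck l (A i))))%:~R + D%:R <= level (A i) e x.
  apply: level_ge; apply: (@reach_flow _ _ _ _ psi_flow T_gt0 _ T) => //.
  by rewrite metric_sym.
have x'2 : reach (radius e) x' (psi (2 * T) x).
  have -> : psi (2 * T) x = psi T x' by rewrite -(flowD psi_flow) mulr_natl mulr2n.
  exact: (reach_flow0 sys T_gt0).
have l2 : level (A i) e (psi (2 * T) x) < (Num.floor (F (deck l (A i))))%:~R + D%:R.
  rewrite ltNge; apply/negP => /(level_reach al)[[k k0 xk]|].
    have {}xk : reach (2 * radius e) x' (deck k x').
      by apply: reach_trans xk; apply: reach_le x'2; arith.
    have k0' : k = 0.
      by have := no_ascent (reach_le r_eps0 xk); lia.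
    by apply: nx'; apply: (reach_le r_eps); rewrite k0' (deck0 sys) in xk.
  by have := F_reach (reach_le (radius_le e) x'2); have := D_big; have := C_ge0; arith.
apply: le_lt_trans (_ : _ <= level (A i) e (psi (2 * T) x)) _.
  have -> : psi (3 * T) x = psi T (psi (2 * T) x).
    by rewrite -(flowD psi_flow); congr psi; arith.
  exact: (smooth_max_flow F_b re (radius_le e) (marked_close _)).
apply: lt_le_trans l2 _; apply: le_trans lx _.
exact: (smooth_max_ge0 F_b re (radius_le e) (marked_close _)).
Qed.

(** The index encodes the centre [c], the radius [e] and a multiple [k] of the time step [T / m.+1];
    cutting at [3 * T] keeps all members within one bound of [F]. *)
Definition family (i : nat) : X -> R :=
  let: (c, e, m, k) := odflt (0, 0, 0, 0)%N (unpickle i : option (nat * nat * nat * nat)) in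
  fun x => smooth_level (A c) e (psi (Num.min (3 * T) (k%:R * (T / m.+1%:R))) x).

Lemma family_index c (e m k : nat) : exists i, family i =
  fun x => smooth_level (A c) e (psi (Num.min (3 * T) (k%:R * (T / m.+1%:R))) x).
Proof. by exists (pickle (c, e, m, k)); rewrite /family pickleK. Qed.

Lemma familyP i : exists c (e : nat) q, 0 <= q <= 3 * T /\
  family i = fun x => smooth_level (A c) e (psi q x).
Proof.
rewrite /family; case: (odflt _ _) => [[[c e] m] k].
exists c, e, (Num.min (3 * T) (k%:R * (T / m.+1%:R))); split => //.
by rewrite le_min ge_min lexx !mulr_ge0 ?invr_ge0 ?ler0n // ltW.
Qed.

Let B : R := 2 * b + C + (D%:R + 1) + 1.

Lemma family_bound i x : `|family i x - F x| <= B.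
Proof.
have [c [e [q [qT ->]]]] := familyP i.
exact: (smooth_max_bound b_ge0 F_b (radius_gt0 e) (radius_le e) (marked_close _)).
Qed.

Lemma family_continuous i : continuous (family i).
Proof.
have [c [e [q [_ ->]]]] := familyP i => x.
apply: (@cvg_comp _ _ _ (psi q) (smooth_level (A c) e) _ (nbhs (psi q x))).
  apply/metricType_numDomainType.cvgrPdist_lt => v v0.
  have [d d0 dP] := flow_uniform sys `|q| v0; apply/near_mdistP.
  by exists d => // y; exact: dP.
exact: (smooth_max_continuous F_b (radius_gt0 e) (radius_le e) (@marked_close _)).
Qed.

Lemma family_equivariant i : Z_equivariant deck (family i).
Proof.
move=> k x; have [c [e [q [_ ->]]]] := familyP i; rewrite (deck_flow sys).
exact: (smooth_max_equivariant F_b (radius_gt0 e) (radius_le e)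
  (marked_equivariant _) (marked_close _)).
Qed.

Lemma family_nonincreasing i x t : 0 <= t -> family i (psi t x) <= family i x.
Proof.
move=> t0; have [c [e [q [_ ->]]]] := familyP i.
rewrite -(flowD psi_flow) addrC (flowD psi_flow).
exact: (smooth_max_nonincreasing b_ge0 D1_ge0 F_b (radius_gt0 e) (radius_le e)
  (marked_close _)).
Qed.

Lemma smooth_level_recurrent c (e : nat) q x : chains x x -> 0 <= q ->
  smooth_level (A c) e (psi q x) = level (A c) e x.
Proof.
exact: (smooth_max_recurrent_flow F_b (radius_gt0 e) (radius_le e) (@marked_close _)).
Qed.

Lemma family_chains i x y : chains x y -> chains y x -> family i x = family i y.
Proof.
move=> xy yx; have xx := chains_trans xy yx; have yy := chains_trans yx xy.
have [c [e [q [/andP[q0 _] ->]]]] := familyP i; rewrite !smooth_level_recurrent //.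
have mono := reach_max_mono (radius_gt0 e) (radius_le e) (marked_close (A c)).
by apply/eqP; rewrite eq_le !mono //; [exact: (xy _ (radius_gt0 e))|exact: (yx _ (radius_gt0 e))].
Qed.

Lemma family_integral i x y : chains x x -> chains y y ->
  exists k, family i x - family i y = k%:~R.
Proof.
move=> xx yy; have [c [e [q [/andP[q0 _] ->]]]] := familyP i; rewrite !smooth_level_recurrent //.
have att := reach_max_attained (radius_gt0 e) (radius_le e) (marked_close (A c)).
rewrite /level; have [z _ ->] := att x; have [w _ ->] := att y.
by exists (marked (A c) z - marked (A c) w); rewrite intrB.
Qed.

(** The drop over time [3 * T] is cut into steps of length [s <= t]. It is strict on some step, and
    the translate by the start of that step sees it at [x]. *)
Lemma family_drops x t : ~ chains x x -> 0 < t ->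
  exists i s, [/\ 0 <= s <= t & family i (psi s x) < family i x].
Proof.
move=> /smooth_level_drops[c [e drop]] t0; set g := smooth_level (A c) e in drop.
pose m := Num.truncn (T / t); pose s := T / m.+1%:R.
have s0 : 0 < s by rewrite divr_gt0.
have st : s <= t by rewrite ler_pdivrMr // mulrC -ler_pdivrMr // ltW // truncnS_gt.
have sm : m.+1%:R * s = T by rewrite mulrC divfK // pnatr_eq0.
have [k kP] : exists k : nat, (k < 3 * m.+1)%N /\ g (psi (k.+1%:R * s) x) < g (psi (k%:R * s) x).
  apply: contrapT => H; suff : g x <= g (psi (3 * T) x) by rewrite leNgt drop.
  have -> : 3 * T = (3 * m.+1)%:R * s by rewrite natrM -mulrA sm.
  have : (3 * m.+1 <= 3 * m.+1)%N by [].
  elim: {1 3}(3 * m.+1)%N => [_|j IH jm]; first by rewrite mul0r (flow0 psi_flow).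
  apply: le_trans (IH (ltnW jm)) _; rewrite leNgt; apply/negP => lt.
  by apply: H; exists j.
have [i iE] := family_index c e m k; exists i, s; rewrite iE (ltW s0) st; split => //.
have -> : Num.min (3 * T) (k%:R * (T / m.+1%:R)) = k%:R * s.
  rewrite min_r // -/s -sm mulrA ler_pM2r // -natrM ler_nat.
  by case: kP => /ltnW.
rewrite -(flowD psi_flow) -[X in _ + X]mul1r -mulrDl natr1; exact: kP.2.
Qed.

Theorem lyapunov_from_reach_bound : exists h : X -> R, Z_equivariant deck h /\ lyapunov psi T h.
Proof.
have B0 : 0 <= B by rewrite !addr_ge0 // mulr_ge0.
(* This gives both [4 * B * l < 1] and [l < 1], even if [B = 0]. *)
pose l := (4 * B + 2)^-1.
have B2 : 0 < 4 * B + 2 by rewrite ltr_wpDl // mulr_ge0.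
have l01 : 0 < l < 1 by rewrite invr_gt0 B2 invf_lt1 //; arith.
have Bl : 4 * B * l < 1 by rewrite ltr_pdivrMr // mul1r; arith.
have h_le := mixture_le l01 family_bound.
exists (mixture family F B l); split=> [k x|].
  apply: (mixture_shift l01 family_bound) => [|i]; [exact: F_eq|exact: family_equivariant].
have h_noninc x t : 0 <= t -> mixture family F B l (psi t x) <= mixture family F B l x.
  by move=> t0; apply: h_le => i; exact: family_nonincreasing.
split.
- exact: (mixture_continuous l01 family_bound F_cont family_continuous).
- move=> K /(recurrence_chainP sys T_gt0)[z zz ->] x y [zx xz] [zy yz].
  have xy := chains_trans xz zy; have yx := chains_trans yz zx.
  apply/eqP; rewrite eq_le; apply/andP; split; apply: h_le => i.
    by rewrite (@family_chains i x y).
  by rewrite (@family_chains i x y).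
- move=> K L /(recurrence_chainP sys T_gt0)[z zz ->] /(recurrence_chainP sys T_gt0)[w ww ->].
  move=> zw x y [zx xz] [wy yw] hxy; apply: zw.
  have xx := chains_trans xz zx; have yy := chains_trans yw wy.
  have fxy := mixture_separates l01 family_bound Bl (fun i => family_integral i xx yy) hxy.
  have lxy c (e : nat) : level (A c) e x = level (A c) e y.
    have [i iE] := family_index c e 0 0; have := fxy i; rewrite iE.
    by rewrite !smooth_level_recurrent // mul0r le_min lexx mulr_ge0 // ltW.
  have xy := same_levels_chains xx yy lxy.
  have yx := same_levels_chains yy xx (fun c (e : nat) => esym (lxy c e)).
  apply/seteqP; split => v [zv vz]; split.
  + by apply: (chains_trans wy); apply: (chains_trans yx); apply: (chains_trans xz).
  + by apply: (chains_trans vz); apply: (chains_trans zx); apply: (chains_trans xy).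
  + by apply: (chains_trans zx); apply: (chains_trans xy); apply: (chains_trans yw).
  + by apply: (chains_trans vz); apply: (chains_trans wy); apply: (chains_trans yx).
- move=> x t nxx t0; have {}nxx : ~ chains x x by move/(recurrent_chains sys T_gt0).
  have [i [s [/andP[s0 st] drop]]] := family_drops nxx t0.
  apply: le_lt_trans (_ : _ <= mixture family F B l (psi s x)) _.
    by rewrite -(subrK s t) (flowD psi_flow); apply: h_noninc; rewrite subr_ge0.
  apply: (mixture_lt l01 family_bound _ drop) => j.
  exact: family_nonincreasing.
Qed.

End Assembly.
End Sufficiency.

(** * The two coverings *)

Lemma unique_lift (R : realType) (E : metricType R) (B : Type) (pi : E -> B) (r : R)
    (c1 c2 : R -> E) :
  0 < r -> (forall x y z, mdist x y < r -> mdist x z < r -> pi y = pi z -> y = z) ->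
  continuous c1 -> continuous c2 -> (forall t, pi (c1 t) = pi (c2 t)) ->
  c1 0 = c2 0 -> forall t, c1 t = c2 t.
Proof.
move=> r0 pi_inj cont1 cont2 pi12 c0 t; pose Q s := c1 s = c2 s.
have near (c : R -> E) s : continuous c -> exists2 d : R, 0 < d &
    forall u, `|u - s| < d -> mdist (c s) (c u) < r.
  move=> cc; have /metricType_numDomainType.cvgrPdist_lt/(_ r r0) := cc s.
  move=> /nbhs_ballP[d /= d0 dP]; exists d => // u us.
  by apply: dP; rewrite /ball /= distrC.
apply: (@real_locally_constant _ Q 0) => // s.
have [d1 d10 d1P] := near c1 s cont1; have [d2 d20 d2P] := near c2 s cont2.
exists (Num.min d1 d2) => [|u]; first by rewrite lt_min d10.
rewrite lt_min => /andP[/d1P u1 /d2P u2]; split=> Qs.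
  apply: (pi_inj (c1 u)) => //; first by rewrite metric_sym.
  by rewrite Qs metric_sym.
by apply: (pi_inj (c1 s)) => //; rewrite Qs.
Qed.

Lemma covering_map_open (E B : topologicalType) (p : E -> B) : covering_map p ->
  forall x (A : set E), nbhs x A -> nbhs (p x) (p @` A).
Proof.
move=> cov x A Ax; have [U [S [[oU Ux] SU _ SP]]] := cov (p x).
have [V SV Vx] : (\bigcup_(V in S) V) x by rewrite -SU.
have [oV [_ [g [gc pV gU gp pg]]]] := SP V SV.
have gA : nbhs (g (p x)) A by rewrite gp ?inE.
have UA : nbhs (p x) [set b | U b -> A (g b)].
  by have /subspace_continuousP/(_ _ Ux)/(_ A gA) := gc.
apply: filterS (filterI UA (open_nbhs_nbhs (conj oU Ux))) => b [/= UAb Ub].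
by exists (g b); [exact: UAb|rewrite pg ?inE].
Qed.

Section Covers.
Variables (R : realType) (M : metricType R) (phi : R -> M -> M).
Variables (alpha beta : {additive H1 R M -> int}) (n : nat).
Variables (Mhat : metricType R) (p : continuousType Mhat M) (act : H1 R M -> Mhat -> Mhat).
Variables (phihat : R -> Mhat -> Mhat) (Malpha : metricType R).
Variables (q : Mhat -> Malpha) (palpha : Malpha -> M) (deck : int -> Malpha -> Malpha).
Variable phialpha : R -> Malpha -> Malpha.
Hypotheses (M_compact : compact [set: M]) (n_ge1 : (1 <= n)%N)
  (beta_primitive : primitive_class beta) (alphaE : forall a, alpha a = n%:Z * beta a)
  (Mhat_cover : universal_abelian_cover p act) (Mhat_metric : cover_metric p act)
  (phihat_flow : is_flow phihat) (phihat_lift : flow_lift p phihat phi)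
  (Malpha_cover : kernel_quotient_cover p act alpha beta q palpha deck)
  (Malpha_metric : cover_metric palpha deck)
  (phialpha_flow : is_flow phialpha) (phialpha_lift : flow_lift palpha phialpha phi).

Lemma act_onto a y : exists x, act a x = y.
Proof.
by exists (act (- a) y); rewrite -(actD Mhat_cover) addrN (act0 Mhat_cover).
Qed.

Lemma cover_fibre x y : p x = p y -> exists a, y = act a x.
Proof. by move/(act_fibre Mhat_cover). Qed.

Lemma quotient_deck k x : exists2 a, k = beta a & deck k (q x) = q (act a x).
Proof.
by have [a <-] := beta_primitive k; exists a => //; exact: (quot_deck Malpha_cover).
Qed.

Lemma quotient_continuous : continuous q.
Proof. by apply/continuousP => U /(quot_open Malpha_cover). Qed.

(** The saturation of an open set is the union of its preimages under the elements of the kernel of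
    [alpha]. *)
Lemma quotient_map_open x (A : set Mhat) : nbhs x A -> nbhs (q x) (q @` A).
Proof.
rewrite nbhsE => -[U [oU Ux] UA].
apply: (@filterS _ _ _ (q @` U)); first by move=> _ [z Uz <-]; exists z => //; exact: UA.
apply: open_nbhs_nbhs; split; last by exists x.
apply/(quot_open Malpha_cover).
have -> : q @^-1` (q @` U) = \bigcup_(a in [set a | alpha a = 0]) (act a @^-1` U).
  apply/seteqP; split => [z [u Uu quz]|z [a /= a0 Uaz]].
    have [a [a0 zu]] := (quot_fibre Malpha_cover z u).1 (esym quz).
    by exists a => //=; rewrite -zu.
  exists (act a z) => //; apply/esym/(quot_fibre Malpha_cover).
  by exists a.
apply: bigcup_open => a _; move: U oU {Ux UA}; apply/continuousP.
exact: (act_continuous Mhat_cover).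
Qed.

Lemma quotient_fibre y y' : palpha y = palpha y' -> exists k, y' = deck k y.
Proof.
have [x <-] := quot_surjective Malpha_cover y; have [x' <-] := quot_surjective Malpha_cover y'.
rewrite !(quot_proj Malpha_cover) => /cover_fibre[a ->].
by exists (beta a); rewrite (quot_deck Malpha_cover).
Qed.

Lemma quotient_surjective b : exists y, palpha y = b.
Proof.
have [x <-] := cover_surjective Mhat_cover b; exists (q x).
exact: (quot_proj Malpha_cover).
Qed.

Lemma palpha_open y (A : set Malpha) : nbhs y A -> nbhs (palpha y) (palpha @` A).
Proof.
have [x <-] := quot_surjective Malpha_cover y; rewrite (quot_proj Malpha_cover) => Ay.
have /(covering_map_open (cover_covering Mhat_cover)) := @quotient_continuous x A Ay.
apply: filterS => _ [z /= Az <-]; exists (q z) => //; exact: (quot_proj Malpha_cover).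
Qed.

Lemma palpha_deck k y : palpha (deck k y) = palpha y.
Proof.
have [x <-] := quot_surjective Malpha_cover y; have [a _ ->] := quotient_deck k x.
by rewrite !(quot_proj Malpha_cover); apply/esym/(act_fibre Mhat_cover); exists a.
Qed.

Lemma palpha_inj : exists2 r : R, 0 < r & forall x y z,
  mdist x y < r -> mdist x z < r -> palpha y = palpha z -> y = z.
Proof.
have [r r0 rP] := metric_local Malpha_metric; exists r => // x y z xy xz yz.
by apply: mdist_positivity; rewrite -(rP x) ?ballEmdist // yz mdistxx.
Qed.

Lemma isometry_continuous (f : Malpha -> Malpha) :
  (forall x y, mdist (f x) (f y) = mdist x y) -> continuous f.
Proof.
move=> fi x; apply/metricType_numDomainType.cvgrPdist_lt => e e0.
by apply/near_mdistP; exists e => // y; rewrite fi.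
Qed.

(** Both sides lift the orbit of [palpha y] and start at [deck k y]. *)
Lemma deck_phialpha k t y : phialpha t (deck k y) = deck k (phialpha t y).
Proof.
have [r r0 rP] := palpha_inj; move: t.
apply: (unique_lift r0 rP).
- exact: orbit_continuous.
- move=> t; apply: (@cvg_comp _ _ _ (phialpha ^~ y) (deck k) _ (nbhs (phialpha t y))).
    exact: orbit_continuous.
  exact: (isometry_continuous (metric_deck Malpha_metric k)).
- by move=> t; rewrite phialpha_lift !palpha_deck phialpha_lift.
- by rewrite !(flow0 phialpha_flow).
Qed.

(** Both sides lift the orbit of [p x] through [palpha] and start at [q x]. *)
Lemma quotient_flow t x : q (phihat t x) = phialpha t (q x).
Proof.
have [r r0 rP] := palpha_inj; move: t.
apply: (unique_lift r0 rP).
- move=> t; apply: (@cvg_comp _ _ _ (phihat ^~ x) q _ (nbhs (phihat t x))).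
    exact: orbit_continuous.
  exact: quotient_continuous.
- exact: orbit_continuous.
- by move=> t; rewrite phialpha_lift !(quot_proj Malpha_cover) phihat_lift.
- by rewrite (flow0 phihat_flow) (flow0 phialpha_flow).
Qed.

Lemma cover_uniform : uniform_principle act.
Proof.
apply: (compact_uniform_principle M_compact) (cover_surjective Mhat_cover) _ cover_fibre.
exact: (covering_map_open (cover_covering Mhat_cover)).
Qed.

Lemma quotient_Z_cover_flow : Z_cover_flow phialpha deck.
Proof.
have deckq a x : deck (beta a) (q x) = q (act a x) := quot_deck Malpha_cover a x.
split.
- exact: phialpha_flow.
- exact: (metric_deck Malpha_metric).
- move=> y; have [x <-] := quot_surjective Malpha_cover y.
  by rewrite -(raddf0 beta) deckq (act0 Mhat_cover).
- move=> k l y; have [x <-] := quot_surjective Malpha_cover y.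
  have [a <-] := beta_primitive k; have [c <-] := beta_primitive l.
  by rewrite -raddfD !deckq (actD Mhat_cover).
- move=> k t y; exact: deck_phialpha.
(* A small displacement fixes [y], as [palpha] is injective on small balls. Freeness of [act] then
   puts [a] in the kernel of [alpha], which is that of [beta] because [n] is non-zero. *)
- have [r r0 rP] := palpha_inj; exists r => // k y yk.
  have : deck k y = y.
    by apply: (rP y) => //; rewrite ?mdistxx // palpha_deck.
  have [x <-] := quot_surjective Malpha_cover y; have [a -> ->] := quotient_deck k x.
  move=> /esym/(quot_fibre Malpha_cover)[c [c0 ac]].
  have ac0 : act (a - c) x = x.
    by rewrite addrC (actD Mhat_cover) ac -(actD Mhat_cover) addNr (act0 Mhat_cover).
  have /eqP := act_free Mhat_cover ac0; rewrite subr_eq0 => /eqP ->.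
  have /eqP := c0; rewrite alphaE mulf_eq0 => /orP[|/eqP//].
  by move=> /eqP[n0]; move: n_ge1; rewrite n0.
- apply: (compact_uniform_principle M_compact) quotient_surjective palpha_open quotient_fibre.
- apply: (compact_finite_net M_compact) quotient_surjective palpha_open quotient_fibre.
Qed.

(** * Transfer of chains between the two coverings *)

Variable T : R.
Hypothesis T_gt0 : 0 < T.

Lemma reach_project eps d x y :
  (forall x y, mdist x y < d -> mdist (q x) (q y) < eps) ->
  reach phihat T d x y -> reach phialpha T eps (q x) (q y).
Proof.
move=> qd; have J z w : jump phihat T d z w -> jump phialpha T eps (q z) (q w).
  by move=> [t tT zw]; exists t => //; rewrite -quotient_flow; exact: qd.
elim=> [{}x {}y /J|{}x {}y z /J xy _ IH]; first exact: reach_jump.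
exact: reach_cons xy IH.
Qed.

(** Openness of [q] lifts points near [q x] to points near [x]; invariance under [act] makes the
    scale uniform. *)
Lemma quotient_lift_near (e : R) : 0 < e -> exists2 d, 0 < d &
  forall x y, mdist (q x) y < d -> exists2 y', q y' = y & mdist x y' < e.
Proof.
move=> e0; have [|||d d0 dP] := cover_uniform (P := fun d x =>
    forall y, mdist (q x) y < d -> exists2 y', q y' = y & mdist x y' < e); last by exists d.
- move=> a d x dP y; have deckq := quot_deck Malpha_cover a x.
  rewrite -deckq => xy; have [|z zy xz] := dP (deck (- beta a) y).
    rewrite -(metric_deck Malpha_metric (beta a)).
    by rewrite -(deckD quotient_Z_cover_flow) addrN (deck0 quotient_Z_cover_flow).
  exists (act a z); last by rewrite (metric_deck Mhat_metric).
  rewrite -(quot_deck Malpha_cover) zy -(deckD quotient_Z_cover_flow) addrN.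
  exact: (deck0 quotient_Z_cover_flow).
- by move=> d c x cd dP y xy; apply: dP; exact: lt_le_trans cd.
- move=> x; have [r r0 rP] : exists2 r : R, 0 < r & forall y, mdist (q x) y < r ->
      exists2 y', q y' = y & mdist x y' < e / 2.
    have /quotient_map_open/near_mdistP[r r0 rP] : nbhs x [set y | mdist x y < e / 2].
      by apply/near_mdistP; exists (e / 2) => //; rewrite divr_gt0.
    by exists r => // y /rP[y' /= xy' <-]; exists y'.
  have /metricType_numDomainType.cvgrPdist_lt/(_ (r / 2)) := @quotient_continuous x.
  rewrite divr_gt0 // => /(_ isT)/near_mdistP[c c0 cP].
  exists (Num.min (Num.min c (e / 2)) (r / 2)) => [|x']; first by rewrite !lt_min c0 !divr_gt0.
  rewrite !lt_min => /andP[/andP[/cP qxx' xx'] _] y; rewrite !lt_min => /andP[_ x'y].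
  have [|y' <- xy'] := rP y.
    by apply: le_lt_trans (metric_triangle _ (q x') _) _; arith.
  exists y' => //; apply: le_lt_trans (metric_triangle _ x _) _.
  by rewrite metric_sym; arith.
Qed.

Lemma reach_lift eps d x y :
  (forall x y, mdist (q x) y < d -> exists2 y', q y' = y & mdist x y' < eps) ->
  reach phialpha T d (q x) y -> exists2 y', q y' = y & reach phihat T eps x y'.
Proof.
move=> qd; have J z w : jump phialpha T d (q z) w -> exists2 w', q w' = w & jump phihat T eps z w'.
  move=> [t tT]; rewrite -quotient_flow => /qd[w' w'w zw]; exists w' => //.
  by exists t.
move=> xy; move E : (q x) xy => x' xy; elim: xy x E => [{}x' {}y xy x E|{}x' {}y z xy _ IH x E].
  by move: xy; rewrite -E => /J[w wy xw]; exists w => //; exact: reach_jump.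
move: xy; rewrite -E => /J[w wy xw]; have [v vz wv] := IH w wy.
by exists v => //; exact: reach_cons xw wv.
Qed.

Lemma lyapunov_quasi_lyapunov (h : Malpha -> R) :
  Z_equivariant deck h -> lyapunov phialpha T h ->
  quasi_lyapunov_class act phihat T (real_class alpha).
Proof.
move=> h_eq h_lyap f f_cont f_eq; have sys := quotient_Z_cover_flow.
have [e e0 eP] := lyapunov_reach_bound sys T_gt0 h_eq h_lyap.
have h_cont := lyapunov_continuous h_lyap.
have [|d d0 dP] := uniform_continuity (metric_deck Mhat_metric) act_onto cover_uniform
    quotient_continuous (e := e) _ e0.
  by move=> a x y; rewrite -!(quot_deck Malpha_cover) (metric_deck Malpha_metric).
have [||B B0 BP] := invariant_bounded cover_uniform (f := fun x => f x - n%:R * h (q x)).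
- move=> x; apply: cvgB; first exact: f_cont.
  apply: cvgM; first exact: cvg_cst.
  apply: (@cvg_comp _ _ _ q h _ (nbhs (q x))); last exact: h_cont.
  exact: quotient_continuous.
- move=> a x; rewrite f_eq -(quot_deck Malpha_cover) h_eq /real_class /= alphaE intrM.
  by rewrite mulrDr; arith.
(* Along a chain [h] rises by at most 1, hence [n * h] by [n]; passing between [f] and [n * h] costs
   [B] at each end. *)
exists (n%:R + 2 * B), d; split => //; first by rewrite addr_ge0 // mulr_ge0.
move=> l gamma po t tl; have [s [z [s0 zg ->]]] := pseudo_orbit_reach phihat_flow T_gt0 d0 po tl.
have hz : h (q z) <= h (q (gamma 0)) + 1.
  by case: zg => [->|/(reach_project dP)/eP//]; rewrite lerDl.
have := lyapunov_nonincreasing sys T_gt0 h_lyap (q z) s0; rewrite -quotient_flow => hs.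
have : n%:R * h (q (phihat s z)) <= n%:R * (h (q (gamma 0)) + 1).
  by rewrite ler_wpM2l //; arith.
have := BP (phihat s z); have := BP (gamma 0); rewrite !ler_norml; arith.
Qed.

Lemma quasi_lyapunov_lyapunov :
  quasi_lyapunov_class act phihat T (real_class alpha) ->
  exists h : Malpha -> R, Z_equivariant deck h /\ lyapunov phialpha T h.
Proof.
move=> ql; have sys := quotient_Z_cover_flow.
(* The enumeration of a dense set needs a point; on an empty space all conditions are vacuous. *)
have [[x0 _]|no_point] := pselect (exists x : Malpha, True); last first.
  have no (x : Malpha) : False by apply: no_point; exists x.
  exists (fun _ => 0); split=> [k x|]; first by case: (no x).
  split=> [x|K _ x|K L _ _ _ x|x]; by case: (no x).
have [F F_cont F_eq] := equivariant_function sys.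
have n0 : 0 < n%:R :> R by rewrite ltr0n.
have [||C [e [C0 e0 CP]]] := ql (fun x => n%:R * F (q x)).
- move=> x; apply: cvgM; first exact: cvg_cst.
  apply: (@cvg_comp _ _ _ q F _ (nbhs (q x))); last exact: F_cont.
  exact: quotient_continuous.
- move=> a x; rewrite -(quot_deck Malpha_cover) F_eq /real_class /= alphaE intrM.
  by rewrite mulrDr.
have [r r0 rP] := quotient_lift_near e0.
have [|d d0 dP] := real_uniform_continuity (deck_iso sys) (deck_onto sys) (deck_uniform sys)
    F_cont _ ltr01.
  by move=> k x y; rewrite !F_eq; arith.
pose eps0 := Num.min r (d / 2).
have eps0_gt0 : 0 < eps0 by rewrite lt_min r0 divr_gt0.
have [er ed] : eps0 <= r /\ eps0 <= d / 2 by rewrite !ge_min !lexx orbT.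
have Cn0 : 0 <= C / n%:R by rewrite divr_ge0 // ltW.
(* The chain is lifted to [Mhat] and made a pseudo-orbit, to which the bound for [n * F] applies;
   the time 1 of final flow is arbitrary. *)
have F_reach x y : reach phialpha T eps0 x y -> F y <= F x + C / n%:R.
  have [x' <-] := quot_surjective Malpha_cover x => /(reach_le er)/(reach_lift rP)[y' <- xy].
  have [l [gamma [po g0 [t tl gt] _]]] := reach_pseudo_orbit phihat_flow T_gt0 e0 ltr01 xy.
  have := CP l gamma po t tl; rewrite g0 gt => H.
  by rewrite -(ler_pM2l n0) mulrDr mulrCA divff ?gt_eqF // mulr1; arith.
have F_osc y z : mdist y z < 2 * eps0 -> F y <= F z + 1.
  move=> yz; have : mdist y z < d by arith.
  by move=> /dP; rewrite ltr_norml; arith.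
have [b b0 bP] := F_orbit sys T_gt0 F_cont F_eq Cn0 eps0_gt0 F_reach.
have [A AP] := dense_orbits sys x0.
(* Here [truncnS_gt] supplies the height: the integer part of [2 * (C / n) + 6], plus 1. *)
exact: (lyapunov_from_reach_bound sys T_gt0 F_cont F_eq Cn0 eps0_gt0 F_reach F_osc b0 bP
  (truncnS_gt _) AP).
Qed.

End Covers.

Theorem theorem1 (R : realType)
  (M : metricType R) (M_connected : connected [set: M])
  (M_compact : compact [set: M]) (M_manifold : manifold_with_boundary R M)
  (phi : R -> M -> M) (phi_flow : is_flow phi)
  (alpha : {additive H1 R M -> int}) (alpha_neq0 : exists a, alpha a <> 0)
  (n : nat) (n_ge1 : (1 <= n)%N)
  (beta : {additive H1 R M -> int}) (beta_primitive : primitive_class beta)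
  (alphaE : forall a, alpha a = n%:Z * beta a)
  (Mhat : metricType R) (p : continuousType Mhat M)
  (act : H1 R M -> Mhat -> Mhat)
  (Mhat_cover : universal_abelian_cover p act)
  (Mhat_metric : cover_metric p act)
  (phihat : R -> Mhat -> Mhat) (phihat_flow : is_flow phihat)
  (phihat_lift : flow_lift p phihat phi)
  (Malpha : metricType R) (q : Mhat -> Malpha) (palpha : Malpha -> M)
  (deck : int -> Malpha -> Malpha)
  (Malpha_cover : kernel_quotient_cover p act alpha beta q palpha deck)
  (Malpha_metric : cover_metric palpha deck)
  (phialpha : R -> Malpha -> Malpha) (phialpha_flow : is_flow phialpha)
  (phialpha_lift : flow_lift palpha phialpha phi)
  (T : R) (T_gt0 : 0 < T) :
  (exists h : Malpha -> R, Z_equivariant deck h /\ lyapunov phialpha T h) <->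
  quasi_lyapunov_class act phihat T (real_class alpha).
Proof.
split=> [[h [h_eq h_lyap]]|].
  by apply: lyapunov_quasi_lyapunov h_eq h_lyap; eassumption.
by apply: quasi_lyapunov_lyapunov; eassumption.
Qed.
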